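(* Let $I^n=[0,1]^n$ be the unit cube in $\mathbb{R}^n$ and let $t\ge1$ be an integer. Then \[ \lim_{r\to\infty}\frac{\operatorname{las}_t'^{,\mathrm{top}}(rI^n)}{r^n}=\lim_{r\to\infty}\frac{\operatorname{las}'_t(rI^n)}{r^n}. \]
   Context: Regard any $C\subseteq\mathbb{R}^n$ as a graph with vertex set $C$ and edges the pairs $xy$ with $0<|x-y|<2$; an independent set is thus a subset of $C$ whose distinct points are at distance at least $2$. Let $I_{=k,C}$ be the set of independent sets of size exactly $k$, topologized as a subset of the quotient of $C^k$ under $(v_1,\dots,v_k)\mapsto\{v_1,\dots,v_k\}$ (with $I_{=0,C}=\{\emptyset\}$), and let $I_{t,C}$ be the disjoint union of $I_{=k,C}$ for $k=0,\dots,t$, with the disjoint union topology. For $f\colon I_{t,C}\times I_{t,C}\to\mathbb{R}$ and $S\in I_{2t,C}$, set $A_tf(S)=\sum f(J,J')$, the sum being over all ordered pairs $(J,J')$ with $J,J'\in I_{t,C}$ and $J\cup J'=S$. A kernel $K\colon I_{t,C}\times I_{t,C}\to\mathbb{R}$ is positive semidefinite if $K(J,J')=K(J',J)$ and $\sum_{J,J'\in S}w_Jw_{J'}K(J,J')\ge0$ for every finite $S\subseteq I_{t,C}$ and all real weights $w_J$. For $C$ compact, $\operatorname{las}_t'^{,\mathrm{top}}(C)$ is the supremum of $\lambda(I_{=1,C})$ over all finite, regular, nonnegative Borel measures $\lambda$ on $I_{2t,C}$ such that $\lambda(\{\emptyset\})=1$ and $\int_{I_{2t,C}}A_tK\,d\lambda\ge0$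 for every continuous positive semidefinite kernel $K\colon I_{t,C}\times I_{t,C}\to\mathbb{R}$ (i.e., the adjoint $A_t^*\lambda$ is a positive semidefinite measure on $I_{t,C}\times I_{t,C}$). For $C$ bounded, $\operatorname{las}'_t(C)$ is the supremum, over all finite subsets $F\subseteq C$, of $\operatorname{las}_t'^{,\mathrm{top}}(F)$. *)

(* Defs.v *)
From HB Require Import structures.
From mathcomp Require Import all_boot all_order all_algebra finmap.
From mathcomp Require Import all_classical all_reals all_analysis.

Set Implicit Arguments.
Unset Strict Implicit.
Unset Printing Implicit Defensive.

Import Order.TTheory GRing.Theory Num.Theory.
Import numFieldNormedType.Exports.

Local Open Scope classical_set_scope.
Local Open Scope ring_scope.

(* The norm that the library puts on row vectors is the sup norm, hence an
   explicit Euclidean one; both induce the library's topology on 'rV[R]_n. *)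
Definition enorm (R : realType) (n : nat) (x : 'rV[R]_n) : R :=
  Num.sqrt (\sum_(i < n) x 0 i ^+ 2).

Section IndependentSets.
Variables (R : realType) (n : nat).
Implicit Types C : set 'rV[R]_n.

Definition edge C (x y : C) : bool := 0 < enorm (val x - val y) < 2.

Definition independent C (S : {fset C}) : Prop :=
  forall x y : C, x \in S -> y \in S -> ~~ edge x y.

Definition tuple_fset C k (v : 'I_k -> C) : {fset C} :=
  [fset v i | i : 'I_k]%fset.

(* The quotient of C^k by v ~ w iff {v_1, ..., v_k} = {w_1, ..., w_k}; its
   elements are represented by the sets {v_1, ..., v_k} themselves. *)
Definition tuple_quot k C : Type := set_type (range (@tuple_fset C k)).

Definition tuple_quot_pi k C (v : {ptws 'I_k -> C}) : tuple_quot k C :=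
  exist _ (tuple_fset v) (mem_set (imageT (@tuple_fset C k) v)).

Lemma tuple_quot_ex k C (S : tuple_quot k C) :
  exists v, tuple_quot_pi v = S.
Proof.
case: S => S /[dup] /set_mem [v _ vS] p; exists v.
by apply/val_inj.
Qed.

Definition tuple_quot_repr k C (S : tuple_quot k C) : {ptws 'I_k -> C} :=
  projT1 (cid (tuple_quot_ex S)).

Lemma tuple_quot_reprK k C :
  cancel (@tuple_quot_repr k C) (@tuple_quot_pi k C).
Proof. by move=> S; rewrite /tuple_quot_repr; case: cid. Qed.

HB.instance Definition _ k C :=
  isQuotient.Build {ptws 'I_k -> C} (tuple_quot k C) (@tuple_quot_reprK k C).

Definition quot_fset k C (S : quotient_topology (tuple_quot k C)) : {fset C} :=
  val (S : tuple_quot k C).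

(* I_{=k,C}; coerced to a type, it carries the subspace topology. *)
Definition indep_eq k C : set (quotient_topology (tuple_quot k C)) :=
  [set S | #|` quot_fset S| = k /\ independent (quot_fset S)].

(* I_{t,C}, with the library's disjoint union topology on a dependent sum. *)
Definition indep t C : Type := {k : 'I_t.+1 & @indep_eq k C}.

HB.instance Definition _ t C := Topological.on (indep t C).

Definition vset t C (S : indep t C) : {fset C} := quot_fset (val (projT2 S)).

Lemma tuple_fset0 C (v : 'I_0 -> C) : tuple_fset v = fset0.
Proof. by apply/fsetP => x; rewrite inE; apply/negP => /imfsetP[[]]. Qed.

Definition quot_empty C : quotient_topology (tuple_quot 0 C) :=
  tuple_quot_pi (fun i : 'I_0 => False_rect C (notF (ltn_ord i))).

Lemma quot_empty_indep C : quot_empty C \in @indep_eq 0 C.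
Proof.
by apply/mem_set; rewrite /indep_eq /= /quot_fset /= tuple_fset0; split.
Qed.

Definition indep_empty t C : indep t C :=
  existT (fun k : 'I_t.+1 => set_type (@indep_eq k C)) ord0
    (exist _ (quot_empty C) (quot_empty_indep C)).

(* Measurable types are pointed. *)
HB.instance Definition _ t C := isPointed.Build (indep t C) (indep_empty t C).

Definition borel_indep t C := g_sigma_algebraType (@open (indep t C)).

Definition At t C (f : indep t C -> indep t C -> R) (S : indep (2 * t) C) : R :=
  \sum_(p \in [set p : indep t C * indep t C |
                 (vset p.1 `|` vset p.2)%fset = vset S]) f p.1 p.2.

Definition psd_kernel t C (K : indep t C -> indep t C -> R) : Prop :=
  (forall J J', K J J' = K J' J) /\
  (forall (S : {fset indep t C}) (w : indep t C -> R),
     0 <= \sum_(J <- S) \sum_(J' <- S) w J * w J' * K J J').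

(* Outer regular by open sets and inner regular by compact sets; the library's
   measures take unspecified values on nonmeasurable sets, so the sets K are
   required to be measurable. *)
Definition regular_measure t C (lam : set (borel_indep t C) -> \bar R) : Prop :=
  forall A : set (borel_indep t C), measurable A ->
    lam A = ereal_inf [set lam U | U in
              [set U : set (indep t C) | open U /\ A `<=` U]] /\
    lam A = ereal_sup [set lam K | K in
              [set K : set (indep t C) |
                [/\ compact K, (measurable : set (set (borel_indep t C))) K
                  & K `<=` A]]].

Definition las_feasible t C
    (lam : {finite_measure set (borel_indep (2 * t) C) -> \bar R}) : Prop :=
  [/\ regular_measure lam,
      lam [set S | vset S = fset0] = 1%E
    & forall K : indep t C -> indep t C -> R,
        continuous (fun p : indep t C * indep t C => K p.1 p.2) ->
        psd_kernel K ->
        (0 <= \int[lam]_S (At K S)%:E)%E].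

Definition las_top t C : \bar R :=
  ereal_sup [set lam [set S | #|` vset S| = 1%N] | lam in @las_feasible t C].

Definition las t C : \bar R :=
  ereal_sup [set las_top t F | F in
              [set F : set 'rV[R]_n | finite_set F /\ F `<=` C]].

End IndependentSets.

Definition unit_cube (R : realType) (n : nat) : set 'rV[R]_n :=
  [set x | forall i : 'I_n, 0 <= x 0 i <= 1].

Definition dilate (R : realType) (n : nat) (r : R) (A : set 'rV[R]_n) :
  set 'rV[R]_n := [set r *: x | x in A].

Arguments unit_cube : clear implicits.

(* Main.v *)
Require Import Defs.
From HB Require Import structures.
From mathcomp Require Import all_boot all_order all_algebra finmap.
From mathcomp Require Import all_classical all_reals all_analysis.
From mathcomp Require Import measurable_realfun ring lra.
Import Order.TTheory GRing.Theory Num.Theory.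
Import numFieldNormedType.Exports.
Local Open Scope classical_set_scope.
Local Open Scope ring_scope.

Set Implicit Arguments.
Unset Strict Implicit.
Unset Printing Implicit Defensive.

(* A feasible measure lam on the independent sets of C behaves like the moments
   of a random independent set: for disjoint open cliques U_y, the masses
   lam {S | |S| = |V|, S meets U_y for all y in V} again form a feasible point,
   now on a finite set of labels y.  The kernels that prove this are built from
   the functions "max over x in J of h_y(x)", where h_y increases to the
   indicator of U_y, so that only continuous test kernels are used, and dominated
   convergence passes to the limit.  Taking for the U_y the open cells of a fine
   grid, grouped into blocks, and sending each cell to a slightly stretched grid
   point inside s I^n, bounds the mass of the singletons lying in the cells of
   one block by las (s I^n).  A point lies on the walls of at most n among N
   shifted copies of the grid, so averaging over the shifts gives
     las_top (r I^n) <= N / (N - n) * k^n * las (s I^n),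
   with k close to r / s.  Together with las <= las_top this squeezes both
   normalized bounds towards inf_s las (s I^n) / s^n. *)

(** * The space of independent sets *)

Section IndepSets.
Context {R : realType} {n : nat}.
Implicit Types C : set 'rV[R]_n.

Lemma independentS C (S T : {fset C}) :
  (T `<=` S)%fset -> independent S -> independent T.
Proof. by move=> TS iS x y xT yT; apply: iS; exact: (fsubsetP TS). Qed.

Lemma independent_vset t C (J : indep t C) : independent (vset J).
Proof. by case: J => k [S /= Si]; have /set_mem[] := Si. Qed.

Lemma card_vset_tag t C (J : indep t C) : #|` vset J| = projT1 J.
Proof. by case: J => k [S /= Si]; have /set_mem[] := Si. Qed.

Lemma card_vset t C (J : indep t C) : (#|` vset J| <= t)%N.
Proof. by rewrite card_vset_tag -ltnS. Qed.

(** The size of the set recovers its index in the disjoint union; once the indices agree, only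
    subtype projections remain to be inverted. *)
Lemma vset_inj t C : injective (@vset R n t C).
Proof.
move=> J J' JJ'; have := card_vset_tag J; rewrite JJ' card_vset_tag => /val_inj.
case: J J' JJ' => k S [k' S'] /= + kk'; case: _ / kk' S => S.
by rewrite /vset/= => /val_inj/val_inj ->.
Qed.

(** An enumeration of S is a tuple representing it. Hence [vset] identifies [indep t C] with the
    independent sets of size at most t. *)
Lemma vset_surj t C (S : {fset C}) :
  (#|` S| <= t)%N -> independent S -> exists J : indep t C, vset J = S.
Proof.
move=> St iS; rewrite -ltnS in St.
have SE : tuple_fset (fun i : 'I_#|` S| => val (enum_val (cast_ord (cardfE S) i))) = S.
  apply/fsetP => x; apply/imfsetP/idP => [[i _ ->]|xS]; first exact: fsvalP.
  exists (cast_ord (esym (cardfE S)) (enum_rank [` xS]%fset)) => //.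
  by rewrite cast_ordKV enum_rankK.
pose v : {ptws 'I_#|` S| -> C} :=
  (fun i : 'I_#|` S| => val (enum_val (cast_ord (cardfE S) i))).
pose q : quotient_topology (tuple_quot #|` S| C) := tuple_quot_pi v.
have qS : quot_fset q = S by [].
have qi : q \in @indep_eq R n #|` S| C by apply/mem_set; rewrite /indep_eq/= qS.
by exists (existT (fun k : 'I_t.+1 => set_type (@indep_eq R n k C)) (Ordinal St)
  (exist _ q qi)).
Qed.

Lemma finite_indep_subset t C (S : {fset C}) :
  finite_set [set J : indep t C | (vset J `<=` S)%fset].
Proof.
have -> : [set J : indep t C | (vset J `<=` S)%fset] =
    @vset R n t C @^-1` [set` fpowerset S].
  by apply/seteqP; split => J /=; rewrite fpowersetE.
apply: finite_preimage; last exact: finite_fset.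
by move=> ? ? _ _; exact: vset_inj.
Qed.

Lemma finite_setT_set_type (T : Type) (A : set T) :
  finite_set A -> finite_set [set: A].
Proof.
move=> finA; rewrite (_ : [set: A] = @set_val _ A @^-1` A).
  by apply: finite_preimage => // ? ? _ _; exact: val_inj.
by apply/seteqP; split => x // _; exact: set_valP.
Qed.

Lemma finite_indep t C : finite_set C -> finite_set [set: indep t C].
Proof.
move=> /finite_setT_set_type finC.
apply: sub_finite_set (finite_indep_subset t (fset_set [set: C])).
by move=> J _ /=; apply/fsubsetP => x _; rewrite in_fset_set// inE.
Qed.

(** Unfolds the three layers of the topology, disjoint union, subspace and quotient, so that
    openness is checked on tuples in C^k. *)
Lemma open_indepP t C (U : set (indep t C)) :
  (forall k : 'I_t.+1, exists V : set (quotient_topology (tuple_quot k C)),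
    open ((@tuple_quot_pi R n k C) @^-1` V) /\
    forall S : set_type (@indep_eq R n k C),
      U (existT (fun k : 'I_t.+1 => set_type (@indep_eq R n k C)) k S) <-> V (val S)) ->
  open U.
Proof.
move=> UV; apply/sigT_openP => k; have [V [oV VU]] := UV k.
exists V; last by apply/seteqP; split => S /VU.
rewrite /open/= /quotient_open/= unlock; exact: oV.
Qed.

Lemma closed_eq_coord k C (i : 'I_k) (x : C) :
  closed [set v : {ptws 'I_k -> C} | v i = x].
Proof.
have cval : closed ((fun v : {ptws 'I_k -> C} => set_val (v i)) @^-1` [set val x]).
  apply: preimage_closed => [v _|]; last first.
    exact/accessible_closed_set1/hausdorff_accessible/norm_hausdorff.
  have c1 : continuous (fun v : {ptws 'I_k -> C} => v i).
    exact: (@proj_continuous _ (fun=> C) i).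
  have c2 : continuous (@set_val _ C) by exact: initial_continuous.
  exact: (continuous_comp (c1 v) (c2 (v i))).
suff -> : [set v : {ptws 'I_k -> C} | v i = x] =
   (fun v : {ptws 'I_k -> C} => set_val (v i)) @^-1` [set val x] by [].
by apply/seteqP; split => v /= [vx]; [rewrite vx|exact/val_inj].
Qed.

(** The tuples enumerating a fixed finite set are cut out by finitely many closed conditions
    [v i = x]: every coordinate lies in the set, and every element of the set is a coordinate. *)
Lemma closed_indep1 t C (J : indep t C) : closed [set J].
Proof.
rewrite -openC; apply: open_indepP => k.
exists (~` [set q | quot_fset q = vset J]); split; last first.
  move=> S; split=> /= [SJ vS|SJ SJ']; last by apply: SJ; rewrite -SJ'.
  by apply: SJ; apply: vset_inj.
rewrite (_ : _ @^-1` (~` _) =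
  ~` (@tuple_quot_pi R n k C @^-1` [set q | quot_fset q = vset J])) // openC.
have -> : @tuple_quot_pi R n k C @^-1` [set q | quot_fset q = vset J] =
  (\bigcap_(i in [set: 'I_k]) \bigcup_(x in [set` vset J])
     [set v : {ptws 'I_k -> C} | v i = x]) `&`
  (\bigcap_(x in [set` vset J]) \bigcup_(i in [set: 'I_k])
     [set v : {ptws 'I_k -> C} | v i = x]).
  apply/seteqP; split => v; rewrite /= /quot_fset /=.
  - move=> vJ; split=> [i _|x /=].
      by exists (v i) => //=; rewrite -vJ; apply/imfsetP; exists i.
    by rewrite -vJ => /imfsetP[i _ ->]; exists i.
  - move=> [vJ Jv]; apply/fsetP => x; apply/imfsetP/idP => [[i _ ->]|xJ].
      by have [y /= yJ ->] := vJ i I.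
    by have [i _ /= <-] := Jv x xJ; exists i.
apply: closedI; apply: closed_bigI => i _; apply: closed_bigcup => // *;
  by [exact: closed_eq_coord|exact: finite_finset].
Qed.

Lemma bigmax_tuple_fset k C (d : C -> R) (v : 'I_k -> C) :
  \big[Num.max/0]_(x <- tuple_fset v) d x = \big[Num.max/0]_(i < k) d (v i).
Proof.
apply/eqP; rewrite eq_le; apply/andP; split.
  rewrite big_seq; apply: bigmax_le; first exact: bigmax_ge_id.
  by move=> x /imfsetP[i _ ->]; exact: le_bigmax.
apply: bigmax_le; first exact: bigmax_ge_id.
move=> i _; apply: (le_bigmax_seq _ (v i)) => //.
by apply/imfsetP; exists i.
Qed.

Lemma continuous_bigmax (T : topologicalType) (I : Type) (r : seq I) (f : I -> T -> R) (x0 : R) :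
  (forall i, continuous (f i)) ->
  continuous (fun x => \big[Num.max/x0]_(i <- r) f i x).
Proof.
move=> cf; elim: r => [|i r ih] x.
  by under eq_fun do rewrite big_nil; exact: cvg_cst.
under eq_fun do rewrite big_cons.
by apply: (@continuous_max R T (f i)); [exact: cf|exact: ih].
Qed.

(** A maximum, unlike a sum, ignores repetitions as well as order, so on tuples it becomes the
    maximum of the continuous functions [d (v i)]. *)
Lemma continuous_bigmax_vset t C (d : C -> R) : continuous d ->
  continuous (fun J : indep t C => \big[Num.max/0]_(x <- vset J) d x).
Proof.
move=> cd; apply/continuousP => A oA; apply: open_indepP => k.
exists [set q | A (\big[Num.max/0]_(x <- quot_fset q) d x)]; split => //.
have -> : @tuple_quot_pi R n k C @^-1`
    [set q | A (\big[Num.max/0]_(x <- quot_fset q) d x)] =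
    (fun v : {ptws 'I_k -> C} => \big[Num.max/0]_(i < k) d (v i)) @^-1` A.
  by apply/seteqP; split => v /=; rewrite /quot_fset/= bigmax_tuple_fset.
move: A oA; apply/continuousP.
apply: continuous_bigmax => i v.
have c1 : continuous (fun v : {ptws 'I_k -> C} => v i).
  exact: (@proj_continuous _ (fun=> C) i).
exact: (continuous_comp (c1 v) (cd (v i))).
Qed.

(** The size is constant on each summand of the disjoint union. *)
Lemma continuous_card_vset t C (c : nat -> R) :
  continuous (fun J : indep t C => c #|` vset J|).
Proof.
apply/continuousP => A oA; apply: open_indepP => k.
exists [set q | A (c k)]; split.
  have [Ak|nAk] := pselect (A (c k)).
    by rewrite (_ : [set _ | _] = setT); [exact: openT|apply/seteqP; split].
  by rewrite (_ : [set _ | _] = set0); [exact: open0|apply/seteqP; split].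
by move=> S; rewrite /preimage/= card_vset_tag.
Qed.

End IndepSets.

(** * Atomic measures *)

Section AtomicMeasure.
Import HBNNSimple.
Context {d : measure_display} {T : measurableType d} {R : realType}.
Variables (N : nat) (a : nat -> T) (c : nat -> {nonneg R}).

Definition atomic : set T -> \bar R := msum (fun i => mscale (c i) \d_(a i)) N.

HB.instance Definition _ := Measure.on atomic.

Lemma atomicE A : atomic A = (\sum_(i < N) (c i)%:num * (a i \in A)%:R)%:E.
Proof.
by rewrite /atomic /msum -sumEFin; apply: eq_bigr => i _; rewrite EFinM.
Qed.

Let atomic_fin : fin_num_fun atomic.
Proof. by move=> A _; rewrite atomicE. Qed.

HB.instance Definition _ := Measure_isFinite.Build _ _ _ atomic atomic_fin.

Let ge0_integral_atomic_measurable (f : T -> \bar R) :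
  measurable_fun setT f -> (forall x, 0 <= f x)%E ->
  (\int[atomic]_x f x = \sum_(i < N) (c i)%:num%:E * f (a i))%E.
Proof.
move=> mf f0; rewrite ge0_integral_measure_sum//.
by apply: eq_bigr => i _; rewrite ge0_integral_mscale// integral_dirac// diracT mul1e.
Qed.

Hypothesis measurable1 : forall x : T, measurable [set x].

(* The integrand need not be measurable: the integral of a nonnegative function
   is the supremum of the integrals of the simple functions below it, and those
   supported on the atoms suffice. *)
Let ge0_integral_atomic (f : T -> \bar R) : (forall x, 0 <= f x)%E ->
  (\int[atomic]_x f x = \sum_(i < N) (c i)%:num%:E * f (a i))%E.
Proof.
move=> f0; pose D := [set a i | i in `I_N].
have finD : finite_set D by exact: finite_image.
have mD A : A `<=` D -> measurable A.
  move=> AD; have fA : finite_set A by apply: sub_finite_set finD.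
  by rewrite -(image_id A) -bigcup_imset1; apply: fin_bigcup_measurable.
have mfD : measurable_fun setT (f \_ D).
  apply/(measurable_restrictT f (mD D (@subset_refl _ D))).1.
  by move=> _ Y mY; apply: mD => x [].
have -> : (\sum_(i < N) (c i)%:num%:E * f (a i) = \int[atomic]_x (f \_ D) x)%E.
  rewrite ge0_integral_atomic_measurable//; last by move=> x; exact: erestrict_ge0.
  apply: eq_bigr => i _; rewrite patchE mem_set//.
  by exists i => //=.
apply/eqP; rewrite eq_le; apply/andP; split; last first.
  rewrite !ge0_integralTE//; last by move=> x; exact: erestrict_ge0.
  apply: ereal_sup_le => _ [h /= hf <-]; exists h => //= x; apply: (le_trans (hf x)); rewrite patchE.
  by case: ifP.
rewrite ge0_integralTE//; apply: ge_ereal_sup => _ [h /= hf <-].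
have := integral_nnsfun atomic measurableT h.
rewrite patch_setT => <-.
rewrite !ge0_integral_atomic_measurable//.
- apply: lee_sum => i _; apply: lee_wpmul2l => //.
  by rewrite patchE mem_set//; exists i => //=.
- exact/measurable_EFinP.
- by move=> x; rewrite lee_fin.
- by move=> x; exact: erestrict_ge0.
Qed.

Lemma integral_atomic (f : T -> R) :
  (\int[atomic]_x (f x)%:E)%E = (\sum_(i < N) (c i)%:num * f (a i))%:E.
Proof.
rewrite integralE !ge0_integral_atomic// funerpos funerneg.
under eq_bigr do rewrite -EFinM.
under [X in (_ - X)%E]eq_bigr do rewrite -EFinM.
rewrite !sumEFin -EFinB -sumrB; congr EFin; apply: eq_bigr => i _.
rewrite -mulrBr /funrpos /funrneg; congr (_ * _).
by case: (leP (f (a i)) 0) => h; case: (leP (- f (a i)) 0) => h'; lra.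
Qed.
End AtomicMeasure.

(** * Finitely supported measures on independent sets *)

Section AtomicIndep.
Context {R : realType} {n : nat}.
Implicit Types C : set 'rV[R]_n.

Lemma open_borel_indep t C (A : set (indep t C)) : open A ->
  measurable (A : set (borel_indep t C)).
Proof. by move=> oA; exact: sub_sigma_algebra. Qed.

Lemma measurable_indep1 t C (J : borel_indep t C) : measurable [set J].
Proof.
rewrite -[X in measurable X]setCK; apply: measurableC.
by apply: open_borel_indep; rewrite openC; exact: closed_indep1.
Qed.

Lemma finite_closed_indep t C (A : set (indep t C)) : finite_set A -> closed A.
Proof.
move=> fA; have -> : A = \bigcup_(x in A) [set x].
  by rewrite bigcup_imset1 image_id.
by apply: closed_bigcup => // x _; exact: closed_indep1.
Qed.

Lemma finite_measurable_indep t C (A : set (borel_indep t C)) :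
  finite_set A -> measurable A.
Proof.
move=> fA; rewrite -(image_id A) -bigcup_imset1.
by apply: fin_bigcup_measurable => // *; exact: measurable_indep1.
Qed.

(** Removing from the whole space the finitely many atoms outside A leaves an open superset of A
    with the same mass; the atoms inside A form a compact subset with the same mass. *)
Lemma regular_atomic t C N (a : nat -> borel_indep t C) (c : nat -> {nonneg R}) :
  regular_measure (atomic N a c).
Proof.
have mono (A B : set (borel_indep t C)) :
    (forall i, (i < N)%N -> A (a i) -> B (a i)) -> (atomic N a c A <= atomic N a c B)%E.
  move=> AB; rewrite !atomicE lee_fin; apply: ler_sum => i _.
  apply: ler_wpM2l => //; rewrite ler_nat.
  case: (boolP (a i \in A)) => // /set_mem Aa.
  by rewrite mem_set//; exact: AB.
have finP P : finite_set [set a i | i in [set i | (i < N)%N /\ P i]].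
  apply: finite_image; apply: sub_finite_set (finite_II N) => i; exact: proj1.
move=> A mA; split; apply/eqP; rewrite eq_le; apply/andP; split.
- by apply: le_ereal_inf_tmp => _ [U [_ AU] <-]; apply: mono => i _; exact: AU.
- apply: ereal_inf_le.
  exists (atomic N a c (~` [set a i | i in [set i | (i < N)%N /\ ~ A (a i)]])).
    exists (~` [set a i | i in [set i | (i < N)%N /\ ~ A (a i)]]) => //; split.
      by rewrite openC; apply: finite_closed_indep; exact: finP.
    by move=> x Ax [i [_ nA] xi]; apply: nA; rewrite xi.
  by apply: mono => i iN /= nai; apply: contrapT => nA; apply: nai; exists i.
- apply: le_ereal_sup_tmp.
  exists (atomic N a c [set a i | i in [set i | (i < N)%N /\ A (a i)]]).
    exists [set a i | i in [set i | (i < N)%N /\ A (a i)]] => //; split.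
    + exact: finite_compact.
    + exact: finite_measurable_indep.
    + by move=> _ [i [_ Ai] <-].
  by apply: mono => i iN Ai; exists i.
- by apply: ge_ereal_sup => _ [K [_ _ KA] <-]; apply: mono => i _; exact: KA.
Qed.

(** All lower bounds on [las_top] come from finitely supported measures. No measurability of [At K]
    is established: [integral_atomic] evaluates the integral of any real function. *)
Lemma las_top_atomic t C N (a : nat -> indep (2 * t) C) (c : nat -> {nonneg R}) :
  \sum_(i < N) (c i)%:num * (vset (a i) == fset0)%:R = 1 ->
  (forall K : indep t C -> indep t C -> R,
    continuous (fun p : indep t C * indep t C => K p.1 p.2) -> psd_kernel K ->
    0 <= \sum_(i < N) (c i)%:num * At K (a i)) ->
  ((\sum_(i < N) (c i)%:num * (#|` vset (a i)| == 1)%:R)%:E <= las_top t C)%E.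
Proof.
move=> c1 Kge0; apply: ereal_sup_ubound.
exists (atomic N (a : nat -> borel_indep (2 * t) C) c); last first.
  rewrite [LHS](@atomicE _ (borel_indep (2 * t) C) R N a c _).
  congr EFin; apply: eq_bigr => i _; congr (_ * (nat_of_bool _)%:R).
  by apply/idP/idP => [/set_mem/=/eqP//|/eqP ?]; exact/mem_set.
split.
- exact: regular_atomic.
- rewrite [LHS](@atomicE _ (borel_indep (2 * t) C) R N a c _) -[RHS](congr1 EFin c1).
  congr EFin; apply: eq_bigr => i _; congr (_ * (nat_of_bool _)%:R).
  by apply/idP/idP => [/set_mem/=/eqP//|/eqP ?]; exact/mem_set.
- move=> K cK psdK; rewrite (@integral_atomic _ (borel_indep (2 * t) C)) ?lee_fin ?Kge0//.
  exact: measurable_indep1.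
Qed.
End AtomicIndep.

(** * Bump functions on finite sets of points *)

Section Bumps.
Context {R : realType} {n : nat} {C : set 'rV[R]_n} {Y : choiceType}.
Variable h : Y -> C -> R.
Implicit Types (S : {fset C}) (T : {fset Y}).

(** When S is independent and the support of [h y] is a clique, at most one point of S has [h y]
    positive, and the peak is the value there, or 0 if there is none. *)
Definition peak y S : R := \big[Num.max/0]_(x <- S) h y x.

Definition selected S T : {fset C} :=
  [fset x in S | has (fun y => 0 < h y x) T]%fset.

(** For disjoint supports that are cliques, nonzero on an independent S exactly when S consists of
    one point in the support of each label of T. *)
Definition bump T S : R :=
  (#|` S| == #|` T|)%:R * \prod_(y <- T) peak y S.

Lemma peak_ge0 y S : 0 <= peak y S.
Proof. exact: bigmax_ge_id. Qed.

Lemma peak_gt0P y S : reflect (exists2 x, x \in S & 0 < h y x) (0 < peak y S).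
Proof.
apply: (iffP idP) => [|[x xS hx]]; last first.
  by apply: lt_le_trans hx _; exact: le_bigmax_seq.
apply: contraPP => /forall2NP nh; apply/negP; rewrite -leNgt /peak big_seq.
apply: bigmax_le => // x xS; have [//|/negP] := nh x; by rewrite -leNgt.
Qed.

Lemma peakS y S S' : (S `<=` S')%fset -> 0 < peak y S -> 0 < peak y S'.
Proof.
move=> SS' /peak_gt0P[x xS hx]; apply/peak_gt0P; exists x => //.
exact: (fsubsetP SS').
Qed.

Hypothesis disjoint_h : forall y y' x, 0 < h y x -> 0 < h y' x -> y = y'.
Hypothesis clique_h :
  forall y x x', 0 < h y x -> 0 < h y x' -> x != x' -> edge x x'.

Lemma indep_unique S y x x' : independent S -> x \in S -> x' \in S ->
  0 < h y x -> 0 < h y x' -> x = x'.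
Proof.
move=> iS xS x'S hx hx'; apply/eqP; apply: contraT => xx'.
by have := iS x x' xS x'S; rewrite (clique_h hx hx').
Qed.

Lemma peakE S y x : independent S -> x \in S -> 0 < h y x -> peak y S = h y x.
Proof.
move=> iS xS hx; apply/eqP; rewrite eq_le; apply/andP; split; last first.
  exact: le_bigmax_seq.
rewrite /peak big_seq; apply: bigmax_le => [|x' x'S]; first exact: ltW.
have [hx'|hx'] := ltP 0 (h y x'); last exact: le_trans hx' (ltW hx).
by rewrite (indep_unique iS xS x'S hx hx').
Qed.

Lemma selectedU S T T' :
  selected S (T `|` T')%fset = (selected S T `|` selected S T')%fset.
Proof.
apply/fsetP => x; rewrite !inE -andb_orr; congr (_ && _).
apply/hasP/orP => [[y]|[/hasP[y yT hy]|/hasP[y yT hy]]].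
- by rewrite inE => /orP[yT|yT] hy; [left|right]; apply/hasP; exists y.
- by exists y; rewrite // inE yT.
- by exists y; rewrite // inE yT orbT.
Qed.

(** Sending a selected point to its unique label in T is a bijection: injective because S is
    independent and supports are cliques, onto because all peaks are positive. *)
Lemma card_selected S T : independent S -> {in T, forall y, 0 < peak y S} ->
  #|` selected S T| = #|` T|.
Proof.
move=> iS pT; have [T0|[y0 y0T]] := fset_0Vmem T.
  suff -> : selected S T = fset0 by rewrite T0.
  by apply/fsetP => x; rewrite !inE T0 andbF.
pose g x := head y0 [seq y <- T | 0 < h y x].
have gE x y : y \in T -> 0 < h y x -> g x = y.
  move=> yT hyx; have : y \in [seq y <- T | 0 < h y x] by rewrite mem_filter hyx.
  rewrite /g; case E: [seq _ <- _ | _] => [//|z s] _ /=.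
  have : z \in [seq y <- T | 0 < h y x] by rewrite E mem_head.
  by rewrite mem_filter => /andP[hz _]; exact: disjoint_h hz hyx.
have TE : T = [fset g x | x in selected S T]%fset.
  apply/fsetP => y; apply/idP/imfsetP => [yT|[x /=]].
    have /peak_gt0P[x xS hx] := pT y yT.
    by exists x; [rewrite !inE xS; apply/hasP; exists y|rewrite (gE x y)].
  by rewrite !inE => /andP[xS /hasP[z zT hz]] ->; rewrite (gE x z).
rewrite [in RHS]TE [RHS]card_in_imfset //= => x x' /=.
rewrite !inE => /andP[xS /hasP[z zT hz]] /andP[x'S /hasP[z' z'T hz']].
rewrite (gE x z)// (gE x' z')// => zz'.
by apply: (indep_unique iS xS x'S hz); rewrite zz'.
Qed.

Lemma bump_neq0 T S : bump T S != 0 ->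
  #|` S| = #|` T| /\ {in T, forall y, 0 < peak y S}.
Proof.
rewrite /bump mulf_eq0 negb_or pnatr_eq0 eqb0 negbK => /andP[/eqP -> pn].
split=> // y yT; rewrite lt_neqAle peak_ge0 andbT eq_sym.
apply: contraNneq pn => p0; rewrite prodf_seq_eq0.
by apply/hasP; exists y => //=; rewrite p0 eqxx.
Qed.

(** All points of S are selected, by counting, so S lies in the selected part of S'; both have as
    many points as T. *)
Lemma bump_selected S S' T : independent S' -> (S `<=` S')%fset ->
  bump T S != 0 -> S = selected S' T.
Proof.
move=> iS' SS' /bump_neq0[cS pS].
have iS := independentS SS' iS'.
have cs := card_selected iS pS.
have cs' : #|` selected S' T| = #|` T|.
  by apply: card_selected => // y /pS; exact: peakS.
have sS : selected S T = S.
  by apply/eqP; rewrite eqEfcard cs cS leqnn andbT; apply/fsubsetP => x; rewrite !inE => /andP[].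
apply/eqP; rewrite eqEfcard cs' cS leqnn andbT -{1}sS.
apply/fsubsetP => x; rewrite !inE => /andP[xS ->]; rewrite andbT.
exact: (fsubsetP SS').
Qed.

(** The image under [At] of a product of two bumps. A label common to T and T' contributes the
    square of its peak. *)
Definition bump2 T T' S : R :=
  (#|` S| == #|` T `|` T'|)%fset%:R *
  ((\prod_(y <- T) peak y S) * (\prod_(y <- T') peak y S)).

(* A summand is nonzero only when J and J' are the parts of S covered by the
   labels in T and T', so at most one summand survives. *)
Lemma At_bump t (T T' : {fset Y}) (S : indep (2 * t) C) :
  (#|` T| <= t)%N -> (#|` T'| <= t)%N ->
  At (fun J J' : indep t C => bump T (vset J) * bump T' (vset J')) S =
  bump2 T T' (vset S).
Proof.
move=> Tt T't; have iS : independent (vset S) by exact: independent_vset.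
(* Case distinction: either S has exactly one point for each label of the union of T and T', or both
   sides vanish. *)
have [/andP[/eqP cS /allP pS]|nS] := boolP ((#|` vset S| == #|` T `|` T'|)%fset &&
   all (fun y => 0 < peak y (vset S)) (T `|` T')%fset).
- have pT : {in T, forall y, 0 < peak y (vset S)}.
    by move=> y yT; apply: pS; rewrite inE yT.
  have pT' : {in T', forall y, 0 < peak y (vset S)}.
    by move=> y yT; apply: pS; rewrite inE yT orbT.
  have sub U : (selected (vset S) U `<=` vset S)%fset.
    by apply/fsubsetP => x; rewrite !inE => /andP[].
  have [J vJ] : exists J : indep t C, vset J = selected (vset S) T.
    by apply: vset_surj; [rewrite card_selected|exact: independentS (sub _) iS].
  have [J' vJ'] : exists J : indep t C, vset J = selected (vset S) T'.
    by apply: vset_surj; [rewrite card_selected|exact: independentS (sub _) iS].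
  rewrite /At -(@fsbig_widen _ _ _ _ [set (J, J')])/=.
  + rewrite fsbig_set1/= /bump /bump2 cS eqxx vJ vJ' !card_selected// !eqxx !mul1r.
    (* Peaks do not change on the selected part, since the only point of S where [h y] is positive
       is itself selected. *)
    have pE U y : y \in U -> 0 < peak y (vset S) ->
       peak y (selected (vset S) U) = peak y (vset S).
      move=> yU /peak_gt0P[x xS hx]; rewrite (peakE iS xS hx).
      apply: peakE => //; first exact: independentS (sub _) iS.
      by rewrite !inE xS; apply/hasP; exists y.
    congr (_ * _); apply: eq_big_seq => y yT; apply: pE => //.
      exact: pT.
    exact: pT'.
  (* The union of the two selected parts lies in S and has as many points as S. *)
  + move=> _ ->; rewrite /= vJ vJ'; apply/eqP; rewrite eqEfcard; apply/andP; split.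
      by rewrite fsubUset !sub.
    rewrite -selectedU card_selected ?cS// => y yT; exact: pS.
  + move=> [I I'] /= [II' nII]; apply: contra_notP nII => /eqP.
    rewrite mulf_eq0 negb_or => /andP[bI bI'].
    have IS : (vset I `<=` vset S)%fset by rewrite -II' fsubsetUl.
    have I'S : (vset I' `<=` vset S)%fset by rewrite -II' fsubsetUr.
    congr (_, _); apply: vset_inj.
      by rewrite vJ; exact: bump_selected.
    by rewrite vJ'; exact: bump_selected.
- have -> : bump2 T T' (vset S) = 0.
    move: nS; rewrite negb_and /bump2 => /orP[/negPf ->|/allPn[y yT]].
      by rewrite mul0r.
    rewrite lt_neqAle peak_ge0 andbT negbK => /eqP p0.
    have z U : y \in U -> \prod_(z <- U) peak z (vset S) = 0.
      move=> yU; apply/eqP; rewrite prodf_seq_eq0.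
      by apply/hasP; exists y; rewrite //= -p0.
    by move: yT; rewrite inE => /orP[/z ->|/z ->]; rewrite ?mul0r ?mulr0.
  (* A pair with two nonzero bumps would give S one point per label of the union, contrary to
     [nS]. *)
  apply: fsbig1 => -[I I'] /= II'; apply/eqP; apply: contraNT nS.
  rewrite mulf_eq0 negb_or => /andP[bI bI'].
  have IS : (vset I `<=` vset S)%fset by rewrite -II' fsubsetUl.
  have I'S : (vset I' `<=` vset S)%fset by rewrite -II' fsubsetUr.
  have vI := bump_selected iS IS bI.
  have vI' := bump_selected iS I'S bI'.
  have [_ pI] := bump_neq0 bI.
  have [_ pI'] := bump_neq0 bI'.
  have pS : {in (T `|` T')%fset, forall y, 0 < peak y (vset S)}.
    by move=> y; rewrite inE => /orP[/pI|/pI']; exact: peakS.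
  apply/andP; split; last exact/allP.
  rewrite -(card_selected iS pS) selectedU -vI -vI' II'.
  exact: eqxx.
Qed.

End Bumps.

(** * Linearity of the operator [At] *)

Section AtSums.
Context {R : realType} {n : nat} {C : set 'rV[R]_n} (t : nat).

Lemma finite_At_pairs (S : {fset C}) : finite_set
  [set p : indep t C * indep t C | (vset p.1 `|` vset p.2)%fset = S].
Proof.
pose A := [set J : indep t C | (vset J `<=` S)%fset].
have fA : finite_set A := finite_indep_subset t S.
apply: sub_finite_set (finite_setX fA fA) => -[J J'] /= JS.
by split; rewrite /A /= -JS ?fsubsetUl ?fsubsetUr.
Qed.

Lemma At_sum (I : Type) (s : seq I) (f : I -> indep t C -> indep t C -> R) S :
  At (fun J J' => \sum_(i <- s) f i J J') S = \sum_(i <- s) At (f i) S.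
Proof.
rewrite /At fsbig_finite/=; last exact: finite_At_pairs.
rewrite exchange_big/=; apply: eq_bigr => i _.
by rewrite fsbig_finite//; exact: finite_At_pairs.
Qed.

Lemma AtZ (a : R) (f : indep t C -> indep t C -> R) S :
  At (fun J J' => a * f J J') S = a * At f S.
Proof.
rewrite /At !fsbig_finite/=; try exact: finite_At_pairs.
by rewrite mulr_sumr.
Qed.

End AtSums.

Section BorelReal.
Context {R : realType} {n : nat} {C : set 'rV[R]_n} (t : nat).

Lemma continuous_borel_indep (f : indep t C -> R) : continuous f ->
  measurable_fun setT (f : borel_indep t C -> R).
Proof.
move=> cf; apply: (measurability _ (RGenOInfty.measurableE R)) => _ [_ [x ->] <-].
rewrite setTI; apply: open_borel_indep.
apply: open_comp; first by move=> J _; exact: cf.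
exact: interval_open.
Qed.

Lemma measurable_card_vset k :
  measurable [set J : borel_indep t C | #|` vset J| = k].
Proof.
apply: open_borel_indep.
have -> : [set J : indep t C | #|` vset J| = k] =
   (fun J : indep t C => (#|` vset J| == k)%:R : R) @^-1` [set x | 0 < x].
  by apply/seteqP; split => J /=; rewrite ltr0n lt0b => /eqP.
apply: open_comp => [J _|]; last exact: open_gt.
exact: (@continuous_card_vset R n t C (fun l => (l == k)%:R)).
Qed.

End BorelReal.

(** * Continuous test kernels assembled from bumps *)

Section BumpKernel.
Context {R : realType} {n : nat} {C : set 'rV[R]_n} {Y : choiceType} (t : nat).
Variable h : Y -> C -> R.
Hypothesis continuous_h : forall y, continuous (h y).

Lemma continuous_bump (T : {fset Y}) :
  continuous (fun J : indep t C => bump h T (vset J)).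
Proof.
have c1 : continuous (fun J : indep t C => (#|` vset J| == #|` T|)%:R : R).
  exact: (@continuous_card_vset R n t C (fun k => (k == #|` T|)%:R)).
suff c2 : continuous (fun J : indep t C => \prod_(y <- T) peak h y (vset J)).
  by move=> J; exact: cvgM (c1 J) (c2 J).
apply: (@continuous_big R _ *%R 1 xpredT) => [|y _]; first exact: mul_continuous.
exact: continuous_bigmax_vset.
Qed.

Lemma measurable_bump2 (T T' : {fset Y}) :
  measurable_fun setT (fun S : borel_indep t C => bump2 h T T' (vset S)).
Proof.
have mM (U : {fset Y}) : measurable_fun setT
    (fun S : borel_indep t C => \prod_(y <- U) peak h y (vset S)).
  apply: measurable_prod => y _.
  apply: (@continuous_borel_indep R n C t (fun S => peak h y (vset S))).
  exact: continuous_bigmax_vset.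
apply: measurable_funM; last exact: measurable_funM.
apply: (@continuous_borel_indep R n C t
  (fun S => (#|` vset S| == #|` T `|` T'|)%fset%:R)).
exact: (@continuous_card_vset R n t C (fun k => (k == #|` T `|` T'|)%fset%:R)).
Qed.

Variables (I : Type) (s : seq I) (T : I -> {fset Y}) (K : I -> I -> R).

(** The finite matrix K pulled back along the map sending J to the vector of its bumps. *)
Definition bump_kernel (J J' : indep t C) : R :=
  \sum_(i <- s) \sum_(j <- s)
    K i j * (bump h (T i) (vset J) * bump h (T j) (vset J')).

Lemma continuous_bump_kernel :
  continuous (fun p : indep t C * indep t C => bump_kernel p.1 p.2).
Proof.
apply: (@continuous_big R _ +%R 0 xpredT) => [|i _]; first exact: add_continuous.
apply: (@continuous_big R _ +%R 0 xpredT) => [|j _]; first exact: add_continuous.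
move=> p; apply: cvgM; first exact: cvg_cst.
apply: cvgM.
  apply: (@continuous_comp _ _ _ fst (fun J => bump h (T i) (vset J)) p).
    exact: cvg_fst.
  exact: continuous_bump.
apply: (@continuous_comp _ _ _ snd (fun J => bump h (T j) (vset J)) p).
  exact: cvg_snd.
exact: continuous_bump.
Qed.

Hypothesis K_sym : forall i j, K i j = K j i.
Hypothesis K_psd : forall w : I -> R,
  0 <= \sum_(i <- s) \sum_(j <- s) w i * w j * K i j.

(** The quadratic form of the kernel at weights w is that of K at the vector v, where [v i] is the
    w-weighted sum of the i-th bump. *)
Lemma psd_bump_kernel : psd_kernel bump_kernel.
Proof.
split=> [J J'|A w].
  rewrite /bump_kernel exchange_big/=; apply: eq_bigr => i _; apply: eq_bigr => j _.
  by rewrite K_sym [bump _ _ _ * _]mulrC.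
pose v i := \sum_(J <- A) w J * bump h (T i) (vset J).
suff -> : \sum_(J <- A) \sum_(J' <- A) w J * w J' * bump_kernel J J' =
    \sum_(i <- s) \sum_(j <- s) v i * v j * K i j by exact: K_psd.
under eq_bigr => J _ do under eq_bigr => J' _ do
  (rewrite mulr_sumr; under eq_bigr => i _ do rewrite mulr_sumr).
under eq_bigr => J _ do (rewrite exchange_big; under eq_bigr => i _ do rewrite exchange_big).
rewrite exchange_big; apply: eq_bigr => i _.
rewrite exchange_big; apply: eq_bigr => j _.
rewrite /v mulr_suml mulr_suml; apply: eq_bigr => J _.
rewrite mulr_sumr mulr_suml; apply: eq_bigr => J' _.
by rewrite /=; ring.
Qed.

End BumpKernel.

(** * Sharpening the bumps to indicator functions *)

Section SharpBumps.
Context {R : realType} {n : nat} {C : set 'rV[R]_n} {Y : choiceType}.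
Variable d : Y -> C -> R.
Implicit Types (S : {fset C}) (T V : {fset Y}).

(** Increases with m to the indicator of the open set where [d y] is positive. *)
Definition trunc m y x : R := Num.min 1 (Num.max 0 (m%:R * d y x)).

Definition hits V S : bool :=
  (#|` S| == #|` V|) && all (fun y => 0 < peak d y S) V.

Lemma trunc_gt0 m y x : 0 < trunc m y x -> 0 < d y x.
Proof.
rewrite /trunc lt_min lt_max ltxx/= => /andP[_ mx].
by rewrite ltNge; apply: contraTN mx => dx; rewrite -leNgt mulr_ge0_le0.
Qed.

Lemma peak_trunc_le1 m y S : peak (trunc m) y S <= 1.
Proof. by apply: bigmax_le => // x _; rewrite /trunc ge_min lexx. Qed.

Lemma continuous_trunc m y : continuous (d y) -> continuous (trunc m y).
Proof.
move=> cd x.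
apply: (@continuous_min R C (cst 1) (fun x => Num.max 0 (m%:R * d y x))).
  exact: (@cst_continuous C R 1).
apply: (@continuous_max R C (cst 0) (fun x => m%:R * d y x)); first exact: (@cst_continuous C R 0).
apply: (@cvgM R C (nbhs x)); last exact: cd.
exact: cvg_cst.
Qed.

Lemma cvg_peak_trunc y S :
  peak (trunc m) y S @[m --> \oo] --> ((0 < peak d y S)%R%:R : R).
Proof.
apply: cvg_near_cst; have [/peak_gt0P[x xS dx]|nd] := boolP (0 < peak d y S).
  (* From this index on [m%:R * d y x] is at least 1, so the truncation equals 1 at x. *)
  exists (Num.truncn (d y x)^-1).+1 => // m /= mx.
  apply/eqP; rewrite eq_le peak_trunc_le1/=.
  apply: (bigmax_sup_seq _ x) => //; rewrite /trunc le_min lexx/= le_max.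
  apply/orP; right; rewrite -ler_pdivrMr// div1r.
  apply: le_trans (_ : (Num.truncn (d y x)^-1).+1%:R <= _); last by rewrite ler_nat.
  by rewrite ltW// truncnS_gt.
near=> m; apply/eqP; rewrite eq_le peak_ge0 andbT leNgt.
apply: contra nd => /peak_gt0P[x xS /trunc_gt0 dx].
by apply/peak_gt0P; exists x.
Unshelve. all: by end_near. Qed.

(** Limit peaks are 0 or 1, so the squares on common labels disappear and the limit depends only on
    the union of T and T'. *)
Lemma cvg_bump2_trunc T T' S :
  bump2 (trunc m) T T' S @[m --> \oo] --> ((hits (T `|` T')%fset S)%:R : R).
Proof.
have prodE U : \prod_(y <- U) (0 < peak d y S)%R%:R =
    (all (fun y => 0 < peak d y S)%R U)%:R :> R.
  by elim: U => [|y U ih]; rewrite ?big_nil// big_cons ih/= -natrM mulnb.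
have cprod U : \prod_(y <- U) peak (trunc m) y S @[m --> \oo] -->
    ((all (fun y => 0 < peak d y S)%R U)%:R : R).
  rewrite -prodE; apply: (@cvg_big R _ *%R 1 xpredT); first exact: mul_continuous.
  by move=> y _; exact: cvg_peak_trunc.
have -> : (hits (T `|` T') S)%fset%:R = (#|` S| == #|` T `|` T'|)%fset%:R *
   ((all (fun y => 0 < peak d y S)%R T)%:R * (all (fun y => 0 < peak d y S)%R T')%:R) :> R.
  rewrite -!natrM !mulnb /hits; congr (nat_of_bool (_ && _))%:R.
  by rewrite -all_cat; apply: eq_all_r => y; rewrite mem_cat inE.
by apply: cvgM; [exact: cvg_cst|exact: cvgM].
Qed.

Lemma bump2_trunc_ge0_le1 m T T' S : 0 <= bump2 (trunc m) T T' S <= 1.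
Proof.
have p01 U : 0 <= \prod_(y <- U) peak (trunc m) y S <= 1.
  apply/andP; split; first by apply: prodr_ge0 => *; exact: peak_ge0.
  by apply: prodr_ile1 => *; rewrite peak_ge0 peak_trunc_le1.
have /andP[p0 p1] := p01 T; have /andP[q0 q1] := p01 T'.
rewrite /bump2; case: (_ == _); rewrite ?mul1r ?mul0r ?lexx ?ler01//.
by rewrite mulr_ge0// mulr_ile1.
Qed.

Hypothesis continuous_d : forall y, continuous (d y).
Hypothesis disjoint_d : forall y y' x, 0 < d y x -> 0 < d y' x -> y = y'.
Hypothesis clique_d :
  forall y x x', 0 < d y x -> 0 < d y x' -> x != x' -> edge x x'.

Variable t : nat.

Definition hitting V : set (borel_indep (2 * t) C) := [set S | hits V (vset S)].

Lemma measurable_hitting V : measurable (hitting V).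
Proof.
have -> : hitting V = [set J : borel_indep (2 * t) C | #|` vset J| = #|` V|] `&`
    \bigcap_(y in [set` V]) [set J | 0 < peak d y (vset J)].
  apply/seteqP; split => J; rewrite /hitting/= /hits.
    by move=> /andP[/eqP ? /allP].
  by move=> [-> pJ]; rewrite eqxx; apply/allP.
apply: measurableI; first exact: measurable_card_vset.
apply: fin_bigcap_measurable => // y _; apply: open_borel_indep.
apply: (@open_comp _ _ (fun J : indep (2 * t) C => peak d y (vset J)) [set x | 0 < x]).
  by move=> J _; exact: continuous_bigmax_vset.
exact: open_gt.
Qed.

(** Feasibility is tested on the bump kernels of level m, which [At_bump] evaluates; dominated
    convergence then replaces each bump product by the indicator of a hitting set. *)
Lemma psd_hitting (lam : {finite_measure set (borel_indep (2 * t) C) -> \bar R})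
    (I : Type) (s : seq I) (T : I -> {fset Y}) (K : I -> I -> R) :
  las_feasible lam -> (forall i, (#|` T i| <= t)%N) ->
  (forall i j, K i j = K j i) ->
  (forall w : I -> R, 0 <= \sum_(i <- s) \sum_(j <- s) w i * w j * K i j) ->
  0 <= \sum_(i <- s) \sum_(j <- s) K i j * fine (lam (hitting (T i `|` T j)%fset)).
Proof.
move=> [_ _ lam_psd] Tt K_sym K_psd.
pose f m (S : borel_indep (2 * t) C) :=
  \sum_(i <- s) \sum_(j <- s) K i j * bump2 (trunc m) (T i) (T j) (vset S).
pose g (S : borel_indep (2 * t) C) :=
  \sum_(i <- s) \sum_(j <- s) K i j * (hits (T i `|` T j)%fset (vset S))%:R.
have fE m (S : borel_indep (2 * t) C) : f m S = At (@bump_kernel R n C Y t (trunc m) I s T K) S.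
  rewrite /bump_kernel At_sum; apply: eq_bigr => i _.
  rewrite At_sum; apply: eq_bigr => j _; rewrite AtZ At_bump//.
    by move=> y y' x /trunc_gt0 dx /trunc_gt0; exact: disjoint_d dx.
  by move=> y x x' /trunc_gt0 dx /trunc_gt0; exact: clique_d dx.
have f_ge0 m : (0 <= \int[lam]_S (f m S)%:E)%E.
  under eq_integral do rewrite fE.
  apply: lam_psd; last exact: psd_bump_kernel.
  by apply: continuous_bump_kernel => y; exact: continuous_trunc.
have fg : (\int[lam]_S (f m S)%:E)%E @[m --> \oo] --> (\int[lam]_S (g S)%:E)%E.
  (* The constant B dominates because every [bump2] of truncations lies in [0, 1]. *)
  pose B := \sum_(i <- s) \sum_(j <- s) `|K i j|.
  apply: (@dominated_cvg _ _ _ lam setT _ _ _ (cst B%:E)) => //.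
  - move=> m; apply/measurable_EFinP; apply: measurable_sum => i.
    apply: measurable_sum => j; apply: measurable_funM => //.
    by apply: measurable_bump2 => y; exact: continuous_trunc.
  - move=> S _; apply: cvg_EFin; first exact: nearW.
    apply: (@cvg_big R _ +%R 0 xpredT) => [|i _]; first exact: add_continuous.
    apply: (@cvg_big R _ +%R 0 xpredT) => [|j _]; first exact: add_continuous.
    by apply: cvgM; [exact: cvg_cst|exact: cvg_bump2_trunc].
  - exact: finite_measure_integrable_cst.
  - move=> m S _; rewrite /= lee_fin; apply: le_trans (ler_norm_sum _ _ _) _.
    apply: ler_sum => i _; apply: le_trans (ler_norm_sum _ _ _) _.
    apply: ler_sum => j _; rewrite normrM ler_piMr//.
    by have /andP[b0 b1] := bump2_trunc_ge0_le1 m (T i) (T j) (vset S); rewrite ger0_norm.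
have g_ge0 : (0 <= \int[lam]_S (g S)%:E)%E.
  by apply: (cvge_ge _ fg); exact: nearW.
suff gE : (\int[lam]_S (g S)%:E = (\sum_(i <- s) \sum_(j <- s)
    K i j * fine (lam (hitting (T i `|` T j)%fset)))%:E)%E.
  by rewrite gE lee_fin in g_ge0.
have intK i j : lam.-integrable setT
    (fun S : borel_indep (2 * t) C => (K i j)%:E * (\1_(hitting (T i `|` T j)%fset) S)%:E)%E.
  apply: integrableZl => //; apply: integrable_indic => //.
  exact: measurable_hitting.
have -> : (\int[lam]_S (g S)%:E = \int[lam]_S (\sum_(i <- s) \sum_(j <- s)
    (K i j)%:E * (\1_(hitting (T i `|` T j)%fset) S)%:E))%E.
  apply: eq_integral => S _; rewrite -sumEFin; apply: eq_bigr => i _.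
  rewrite -sumEFin; apply: eq_bigr => j _; rewrite -EFinM indicE.
  by congr (_ * (nat_of_bool _)%:R)%:E; apply/idP/idP => [?|/set_mem//]; exact/mem_set.
rewrite integral_sum//; last by move=> i; apply: integrable_sum.
rewrite -sumEFin; apply: eq_bigr => i _.
rewrite integral_sum// -sumEFin; apply: eq_bigr => j _.
rewrite integralZl//.
  rewrite integral_indic//; last exact: measurable_hitting.
  by rewrite setIT EFinM fineK//; apply: fin_num_measure; exact: measurable_hitting.
by apply: integrable_indic => //; exact: measurable_hitting.
Qed.

End SharpBumps.

(** * Comparison of feasible measures *)

Section Bounds.
Context {R : realType} {n : nat}.
Implicit Types C : set 'rV[R]_n.

Lemma vset_empty t C : vset (indep_empty t C) = fset0.
Proof. exact: tuple_fset0. Qed.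

Lemma vset_eq0 t C (J : indep t C) : (vset J == fset0) = (J == indep_empty t C).
Proof.
apply/eqP/eqP => [J0|->]; last exact: vset_empty.
by apply: vset_inj; rewrite vset_empty.
Qed.

Lemma las_top_ge_atomic t C (I : Type) (i0 : I) (s : seq I)
    (a : I -> indep (2 * t) C) (c : I -> {nonneg R}) :
  \sum_(i <- s) (c i)%:num * (vset (a i) == fset0)%:R = 1 ->
  (forall K : indep t C -> indep t C -> R,
    continuous (fun p : indep t C * indep t C => K p.1 p.2) -> psd_kernel K ->
    0 <= \sum_(i <- s) (c i)%:num * At K (a i)) ->
  ((\sum_(i <- s) (c i)%:num * (#|` vset (a i)| == 1)%:R)%:E <= las_top t C)%E.
Proof.
rewrite !(big_nth i0) !big_mkord => c1 Kge0.
apply: (@las_top_atomic R n t C (size s) (a \o nth i0 s) (c \o nth i0 s)) => //= K cK psdK.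
by have := Kge0 K cK psdK; rewrite (big_nth i0) big_mkord.
Qed.

(** The unit mass at the empty set is feasible: there [At K] is the single diagonal value of K at
    the empty set. *)
Lemma las_top_ge0 t C : (0 <= las_top t C)%E.
Proof.
have := @las_top_ge_atomic t C unit tt [:: tt] (fun=> indep_empty _ C) 
  (fun=> NngNum (@ler01 R)).
rewrite !big_cons !big_nil !addr0 vset_empty eqxx cardfs0 mulr1 mulr0.
apply => // K cK [_ psdK]; rewrite big_cons big_nil addr0 mul1r /At.
have -> : [set p : indep t C * indep t C |
      (vset p.1 `|` vset p.2)%fset = vset (indep_empty (2 * t) C)] =
    [set (indep_empty t C, indep_empty t C)].
  rewrite vset_empty; apply/seteqP; split=> [[J J'] /= /eqP|_ -> /=].
    by rewrite fsetU_eq0 !vset_eq0 => /andP[/eqP -> /eqP ->].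
  by rewrite vset_empty fsetU0.
rewrite fsbig_set1/=.
by have := psdK [fset indep_empty t C]%fset (fun=> 1); rewrite !big_seq_fset1 !mul1r.
Qed.

(** A single label whose cell is all of C, tested with the rank-one matrix of entries 1 and -1 on
    the label sets {} and {[tt]}, gives 1 - 2m + m >= 0 for the mass m of the singletons. *)
Lemma las_top_clique t C : (1 <= t)%N ->
  (forall x y : C, x != y -> edge x y) -> (las_top t C <= 1)%E.
Proof.
move=> t1 cC; apply: ge_ereal_sup => _ [lam lam_feas <-].
pose d (_ : unit) (_ : C) : R := 1.
have [d_cont d_disj d_clique] : [/\ forall y, continuous (d y),
   forall y y' x, 0 < d y x -> 0 < d y' x -> y = y' &
   forall y x x', 0 < d y x -> 0 < d y x' -> x != x' -> edge x x'].
  split; [by move=> y; exact: (@cst_continuous C R 1)|by move=> [] []|].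
  by move=> _ x x' _ _; exact: cC.
pose T (b : bool) : {fset unit} := if b then [fset tt]%fset else fset0.
pose K (b b' : bool) : R := if b == b' then 1 else -1.
have := @psd_hitting R n C unit d d_cont d_disj d_clique t lam bool [:: false; true] T K lam_feas.
rewrite !big_cons !big_nil /T/= !(fset0U, fsetU0, fsetUid) /K/= !addr0 !(mul1r, mulN1r).
have h1 : @hitting R n C unit d t [fset tt]%fset = [set S | #|` vset S| = 1%N].
  apply/seteqP; split => S; rewrite /hitting/= /hits cardfs1.
    by move=> /andP[/eqP].
  move=> S1; rewrite S1/=; apply/allP => -[] _; apply/peak_gt0P.
  have [x xS] : exists x, x \in vset S.
    by have [S0|[x xS]] := fset_0Vmem (vset S); [move: S1; rewrite S0 cardfs0|exists x].
  by exists x => //; exact: ltr01.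
have h0 : @hitting R n C unit d t fset0 = [set S | vset S = fset0].
  apply/seteqP; split => S; rewrite /hitting/= /hits cardfs0.
    by move=> /andP[/eqP/cardfs0_eq].
  by move=> ->; rewrite cardfs0; apply/allP.
have [_ lam0 _] := lam_feas.
have l1 : lam [set S | #|` vset S| = 1%N] \is a fin_num.
  by rewrite -h1; apply: fin_num_measure; exact: measurable_hitting.
rewrite h0 h1 lam0 -[X in (X <= _)%E]fineK// lee_fin /=.
have T_card b : (#|` T b| <= t)%N by case: b; rewrite /T ?cardfs1 ?cardfs0.
have K_sym b b' : K b b' = K b' b by rewrite /K eq_sym.
have K_psd w : 0 <= \sum_(i <- [:: false; true]) \sum_(j <- [:: false; true])
    w i * w j * K i j.
  by rewrite !big_cons !big_nil /K/=; have := sqr_ge0 (w false - w true); lra.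
by move=> /(_ T_card K_sym K_psd); lra.
Qed.

(** Turning the condition on the pair into a 0/1 factor makes the range independent of S, so that
    sums can be exchanged. *)
Lemma At_full t (F : set 'rV[R]_n) (finF : finite_set F) (K : indep t F -> indep t F -> R) S :
  At K S = \sum_(J <- fset_set [set: indep t F]) \sum_(J' <- fset_set [set: indep t F])
    (vset J `|` vset J' == vset S)%fset%:R * K J J'.
Proof.
have finI := finite_indep t finF.
pose s : seq (indep t F) := fset_set [set: indep t F].
have s_all J : J \in s by rewrite /s in_fset_set// inE.
transitivity (\sum_(p <- [seq (J, J') | J <- s, J' <- s] |
    (vset p.1 `|` vset p.2)%fset == vset S) K p.1 p.2).
  rewrite /At fsbig_finite/=; last exact: finite_At_pairs.
  rewrite -[RHS]big_filter.
  suff pe : perm_eq (fset_set [set p : indep t F * indep t F |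
      (vset p.1 `|` vset p.2)%fset = vset S])
    [seq p <- [seq (J, J') | J <- s, J' <- s] |
      (vset p.1 `|` vset p.2)%fset == vset S] by rewrite (perm_big _ pe).
  apply: uniq_perm.
  - exact: fset_uniq.
  - by rewrite filter_uniq// allpairs_uniq ?fset_uniq// => -[? ?] [? ?].
  - move=> [J J']; rewrite in_fset_set; last exact: finite_At_pairs.
    rewrite mem_filter /= allpairs_f// andbT.
    by apply/idP/eqP => [/set_mem|?]; last exact/mem_set.
rewrite big_mkcond big_allpairs; apply: eq_bigr => J _; apply: eq_bigr => J' _ /=.
by case: eqP => _; rewrite ?mul1r ?mul0r.
Qed.

Lemma card_vsetU t C (J J' : indep t C) : (#|` vset J `|` vset J'| <= 2 * t)%fset%N.
Proof.
by rewrite cardfsU (leq_trans (leq_subr _ _))// mul2n -addnn leq_add// card_vset.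
Qed.

Section Discretize.
Variables (t : nat) (C F : set 'rV[R]_n) (d : F -> C -> R).
Hypothesis t_gt0 : (1 <= t)%N.
Hypothesis finF : finite_set F.
Hypothesis continuous_d : forall y, continuous (d y).
Hypothesis disjoint_d : forall y y' x, 0 < d y x -> 0 < d y' x -> y = y'.
Hypothesis clique_d :
  forall y x x', 0 < d y x -> 0 < d y x' -> x != x' -> edge x x'.
Hypothesis edge_d : forall y y' x x',
  0 < d y x -> 0 < d y' x' -> edge y y' -> edge x x'.

(** An edge between two labels would, by [edge_d], be an edge between the points of S that hit
    them. *)
Lemma hits_independent V (S : {fset C}) : independent S -> hits d V S -> independent V.
Proof.
move=> iS /andP[_ /allP pV] y y' yV y'V.
have /peak_gt0P[x xS dx] := pV y yV; have /peak_gt0P[x' x'S dx'] := pV y' y'V.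
by apply: contra (iS x x' xS x'S); exact: edge_d.
Qed.

(** The feasible measure on the label side gives each independent V the mass of [hitting V]. Its
    singletons bound the mass of the union by subadditivity. *)
Lemma las_top_discretize (lam : {finite_measure set (borel_indep (2 * t) C) -> \bar R}) :
  las_feasible lam ->
  (lam (\bigcup_y @hitting R n C F d t [fset y]%fset) <= las_top t F)%E.
Proof.
move=> lam_feas.
pose s : seq (indep (2 * t) F) := fset_set [set: indep (2 * t) F].
have finI := finite_indep (2 * t) finF.
have s_all S : S \in s by rewrite /s in_fset_set// inE.
have mh V : measurable (@hitting R n C F d t V) by exact: measurable_hitting.
have fin_h V : lam (@hitting R n C F d t V) \is a fin_num by exact: fin_num_measure.
have c_ge0 V : 0 <= fine (lam (@hitting R n C F d t V)) by exact: fine_ge0.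
pose c S := NngNum (c_ge0 (vset (S : indep (2 * t) F))).
have cE (V : {fset F}) : (#|` V| <= 2 * t)%N ->
    fine (lam (@hitting R n C F d t V)) = \sum_(S <- s) (c S)%:num * (V == vset S)%:R.
  move=> Vt; have [iV|nV] := pselect (independent V).
    have [S0 VS0] := vset_surj Vt iV.
    rewrite (bigD1_seq S0 (s_all S0) (fset_uniq _))//= VS0 eqxx mulr1 big1 ?addr0// => S SS0.
    by rewrite -VS0 (inj_eq (@vset_inj R n _ F)) eq_sym (negPf SS0) mulr0.
  (* A label set that is not independent is never hit, and it is no [vset], so both sides are 0. *)
  rewrite (_ : @hitting R n C F d t V = set0) ?measure0/=.
    rewrite big1// => S _; have [VS|_] := eqVneq V (vset S); last by rewrite mulr0.
    by case: nV; rewrite VS; exact: independent_vset.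
  rewrite -subset0 => S /= hS; apply: nV; apply: hits_independent hS.
  exact: independent_vset.
have finTF := finite_setT_set_type finF.
apply: le_trans (@las_top_ge_atomic t F _ (indep_empty _ _) s id c _ _).
- apply: le_trans (@content_sub_fsum _ _ _ lam _ [set: F] _
     (fun y => @hitting R n C F d t [fset y]%fset) finTF _ _ (@subset_refl _ _)) _ => //.
    exact: fin_bigcup_measurable.
  rewrite fsbig_finite//=.
  have -> : (\sum_(y <- fset_set [set: F]) lam (@hitting R n C F d t [fset y]%fset) =
      \sum_(y <- fset_set [set: F])
        (fine (lam (@hitting R n C F d t [fset y]%fset)))%:E)%E.
    by apply: eq_bigr => y _; rewrite fineK.
  rewrite sumEFin lee_fin.
  have card1 (y : F) : (#|` [fset y]%fset| <= 2 * t)%N by rewrite cardfs1 muln_gt0.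
  rewrite (eq_bigr _ (fun y _ => cE _ (card1 y))).
  rewrite exchange_big/=; apply: ler_sum => S _; rewrite -mulr_sumr.
  apply: ler_wpM2l => //.
  have [/cardfs1P[y0 Sy]|nS] := boolP (#|` vset S| == 1)%N.
    rewrite (bigD1_seq y0)/= ?fset_uniq ?in_fset_set ?inE// Sy eqxx.
    by rewrite big1 ?addr0// => y yy0; rewrite (inj_eq (@fset1_inj _)) (negPf yy0).
  rewrite big1// => y _; case: eqP => // yS.
  by move: nS; rewrite -yS cardfs1.
- have [_ lam0 _] := lam_feas.
  under eq_bigr do rewrite eq_sym.
  rewrite -cE ?cardfs0//.
  rewrite (_ : @hitting R n C F d t fset0 = [set S | vset S = fset0]) ?lam0//.
  apply/seteqP; split => S; rewrite /hitting/= /hits cardfs0.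
    by move=> /andP[/eqP/cardfs0_eq].
  by move=> ->; rewrite cardfs0; apply/allP.
- move=> K cK [K_sym K_psd].
  have := @psd_hitting R n C F d continuous_d disjoint_d clique_d t lam (indep t F)
    (fset_set [set: indep t F]) (@vset R n t F) K lam_feas (@card_vset R n t F) K_sym
    (K_psd _).
  (* Grouping the pairs of label sets by their union S turns the matrix inequality into the
     feasibility condition. *)
  congr (0 <= _).
  under eq_bigr => J _ do under eq_bigr => J' _ do rewrite (cE _ (card_vsetU _ _)) mulr_sumr.
  under [RHS]eq_bigr => S _ do rewrite (At_full finF) mulr_sumr.
  under eq_bigr => J _ do rewrite exchange_big.
  rewrite exchange_big; apply: eq_bigr => S _; apply: eq_bigr => J _ /=.
  by rewrite mulr_sumr; apply: eq_bigr => J' _; ring.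
Qed.

End Discretize.

End Bounds.

(** * Monotonicity from a finite subset to the whole set *)

Section Monotone.
Context {R : realType} {n : nat} (F C : set 'rV[R]_n).
Hypothesis finF : finite_set F.
Hypothesis FC : F `<=` C.

Definition incl (x : F) : C := exist _ (val x) (mem_set (FC (set_mem (valP x)))).

Lemma incl_inj : injective incl.
Proof. by move=> x y [] /val_inj. Qed.

Lemma card_incl (V : {fset F}) : #|` [fset incl x | x in V]%fset| = #|` V|.
Proof. by rewrite card_imfset//; exact: incl_inj. Qed.

Lemma independent_incl (V : {fset F}) :
  independent [fset incl x | x in V]%fset <-> independent V.
Proof.
split=> iV x y.
  by move=> xV yV; apply: (iV (incl x) (incl y)); rewrite mem_imfset//; exact: incl_inj.
by move=> /imfsetP[x' xV ->] /imfsetP[y' yV ->]; exact: iV.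
Qed.

Lemma embedding_ex m (V : indep m F) :
  exists J : indep m C, vset J = [fset incl x | x in vset V]%fset.
Proof.
apply: vset_surj; first by rewrite card_incl card_vset.
by apply/independent_incl; exact: independent_vset.
Qed.

Definition embedding m (V : indep m F) : indep m C := sval (cid (embedding_ex V)).

Lemma vset_embedding m (V : indep m F) :
  vset (embedding V) = [fset incl x | x in vset V]%fset.
Proof. by rewrite /embedding; case: cid. Qed.

Lemma imfset_incl_inj (V V' : {fset F}) :
  [fset incl x | x in V]%fset = [fset incl x | x in V']%fset -> V = V'.
Proof.
move=> /fsetP VV'; apply/fsetP => x; have := VV' (incl x).
by rewrite !mem_imfset//; exact: incl_inj.
Qed.

Lemma embedding_inj m : injective (@embedding m).
Proof.
move=> V V' VV'; apply: vset_inj; apply: imfset_incl_inj.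
by rewrite -!vset_embedding VV'.
Qed.

Lemma psd_embedding t (K : indep t C -> indep t C -> R) : psd_kernel K ->
  psd_kernel (fun V V' => K (embedding V) (embedding V')).
Proof.
move=> [K_sym K_psd]; split=> [V V'|S w]; first exact: K_sym.
(* Weights on F are carried to C by a left inverse of [embedding], with the empty set as value off
   the image. *)
pose inv J := xget (indep_empty t F) [set V | embedding V = J].
have invK : cancel (@embedding t) inv.
  move=> V; apply: embedding_inj.
  by apply: (xgetPex _ (P := [set V' | embedding V' = embedding V])); exists V.
have := K_psd [fset embedding V | V in S]%fset (w \o inv).
rewrite big_imfset/=; last by move=> ? ? _ _; exact: embedding_inj.
congr (0 <= _); apply: eq_bigr => V _.
rewrite big_imfset/=; last by move=> ? ? _ _; exact: embedding_inj.
by apply: eq_bigr => V' _; rewrite !invK.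
Qed.

(** An independent set contained in an embedded one is itself embedded, so the pairs on the two
    sides correspond. *)
Lemma At_embedding t (K : indep t C -> indep t C -> R) (V : indep (2 * t) F) :
  At K (embedding V) = At (fun J J' => K (embedding J) (embedding J')) V.
Proof.
rewrite /At (reindex_fsbig (fun p => (embedding p.1, embedding p.2))
  [set p : indep t F * indep t F | (vset p.1 `|` vset p.2)%fset = vset V])//.
split.
- by move=> [J J'] /= JJ'; rewrite !vset_embedding -JJ' imfsetU.
- by move=> [J J'] [I I'] _ _ /= [] /embedding_inj -> /embedding_inj ->.
- have pre (J : indep t C) : (vset J `<=` vset (embedding V))%fset ->
      exists I : indep t F, embedding I = J.
    move=> JV.
    have JE : vset J = [fset incl x | x in [fset x in vset V | incl x \in vset J]]%fset.
      apply/fsetP => x; apply/idP/imfsetP => [xJ|[y /=]]; last first.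
        by rewrite !inE => /andP[_ ?] ->.
      have := fsubsetP JV _ xJ; rewrite vset_embedding => /imfsetP[y /= yV xy].
      by exists y; rewrite // !inE yV -xy.
    have [I IE] : exists I : indep t F, vset I = [fset x in vset V | incl x \in vset J]%fset.
      apply: vset_surj; first by rewrite -card_incl -JE card_vset.
      by apply/independent_incl; rewrite -JE; exact: independent_vset.
    by exists I; apply: vset_inj; rewrite vset_embedding IE -JE.
  move=> [J J'] /= JJ'.
  have [I IJ] : exists I, embedding I = J by apply: pre; rewrite -JJ' fsubsetUl.
  have [I' IJ'] : exists I, embedding I = J' by apply: pre; rewrite -JJ' fsubsetUr.
  exists (I, I'); rewrite /= ?IJ ?IJ'//; apply: imfset_incl_inj.
  by rewrite imfsetU -!vset_embedding IJ IJ'.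
Qed.

(** A finite space with closed points is discrete. *)
Lemma open_indep_finite m (A : set (indep m F)) : open A.
Proof.
rewrite -[A]setCK openC; apply: finite_closed_indep.
by apply: sub_finite_set (finite_indep m finF).
Qed.

Lemma continuous_indep_finite m (T : topologicalType) (f : indep m F * indep m F -> T) :
  continuous f.
Proof.
move=> [J J'] A /nbhs_singleton fA; exists ([set J], [set J']).
  by split; apply: open_nbhs_nbhs; split=> //; exact: open_indep_finite.
by move=> [I I'] /= [-> ->].
Qed.

Lemma integral_indep_finite m (lam : {finite_measure set (borel_indep m F) -> \bar R})
    (f : indep m F -> R) :
  (\int[lam]_V (f V)%:E = (\sum_(V <- fset_set [set: indep m F])
     fine (lam [set V : borel_indep m F]) * f V)%:E)%E.
Proof.
have finI := finite_indep m finF.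
have m1 (V : borel_indep m F) : measurable [set V] by exact: measurable_indep1.
have int1 V : lam.-integrable setT
    (fun S : borel_indep m F => (f V)%:E * (\1_[set V] S)%:E)%E.
  by apply: integrableZl => //; exact: integrable_indic.
have -> : (\int[lam]_V (f V)%:E = \int[lam]_S
    (\sum_(V <- fset_set [set: indep m F]) (f V)%:E * (\1_[set V] S)%:E))%E.
  apply: eq_integral => S _.
  rewrite (bigD1_seq S)/= ?fset_uniq ?in_fset_set ?inE// indicE mem_set// mule1.
  rewrite big1 ?adde0// => V VS; rewrite indicE memNset ?mule0//=.
  by move=> SV; rewrite SV eqxx in VS.
rewrite integral_sum// -sumEFin; apply: eq_bigr => V _.
rewrite integralZl//; last exact: integrable_indic.
by rewrite integral_indic// setIT EFinM fineK ?fin_num_measure// muleC.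
Qed.

(* Every function on the finite space of independent sets of F is continuous, so
   the push-forward of a measure is tested by restricted kernels. *)
Lemma las_top_subset t : (las_top t F <= las_top t C)%E.
Proof.
apply: ge_ereal_sup => _ [lam [_ lam0 lam_psd] <-].
have finI := finite_indep (2 * t) finF.
pose s : seq (indep (2 * t) F) := fset_set [set: indep (2 * t) F].
have c_ge0 V : 0 <= fine (lam [set V : borel_indep (2 * t) F]) by exact: fine_ge0.
pose c V := NngNum (c_ge0 V).
have mA (A : set (borel_indep (2 * t) F)) : measurable A.
  by apply: open_borel_indep; exact: open_indep_finite.
have cE (A : set (borel_indep (2 * t) F)) :
    lam A = (\sum_(V <- s) (c V)%:num * (V \in A)%:R)%:E.
  have := integral_indep_finite lam (\1_A).
  by rewrite integral_indic// setIT => ->.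
rewrite cE.
have -> : \sum_(V <- s) (c V)%:num * (V \in [set S | #|` vset S| = 1%N])%:R =
    \sum_(V <- s) (c V)%:num * (#|` vset (embedding V)| == 1%N)%:R.
  apply: eq_bigr => V _; rewrite vset_embedding card_incl.
  by congr (_ * (nat_of_bool _)%:R); apply/idP/eqP => [/set_mem|?]; last exact/mem_set.
apply: (las_top_ge_atomic (indep_empty _ _)).
- apply: EFin_inj; rewrite -lam0 cE; congr EFin; apply: eq_bigr => V _.
  congr (_ * (nat_of_bool _)%:R); rewrite vset_embedding -cardfs_eq0 card_incl cardfs_eq0.
  by apply/eqP/idP => [?|/set_mem//]; exact/mem_set.
- move=> K cK psdK.
  have := lam_psd _ _ (psd_embedding psdK).
  rewrite integral_indep_finite lee_fin.
  under eq_bigr do rewrite -At_embedding.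
  apply; exact: continuous_indep_finite.
Qed.

End Monotone.

(** * Discretization on a grid *)

Section Cells.
Context {R : realType}.

(** Two shifts putting u on a wall would differ by an integer, yet the shifts w / N are less than 1
    apart. So each coordinate spoils at most one shift. *)
Lemma card_grid_hits (N : nat) (u : R) :
  (#|[pred w : 'I_N | `[< exists m : nat, (u + w%:R / N%:R = m%:R)%R >]]| <= 1)%N.
Proof.
apply/card_le1_eqP => w w' /asboolP[m um] /asboolP[m' um'].
have N0 : (0 < N)%N by apply: leq_ltn_trans (ltn_ord w).
have N0' : N%:R != 0 :> R by rewrite pnatr_eq0 -lt0n.
have E : (w + m' * N = w' + m * N)%N.
  apply/eqP; rewrite -(eqr_nat R) !natrD !natrM -um -um'.
  by apply/eqP; field.

by apply/esym; apply: val_inj; rewrite /= -(modn_small (ltn_ord w)) -(modnMDl m' w N) addnC E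
  addnC modnMDl modn_small.
Qed.

(** The cell number z is the integer part of the shifted, rescaled coordinate; division by q splits
    it into the block b and the position p inside it. *)
Lemma cell_ex (N q k : nat) (del r x : R) (w : 'I_N) :
  0 < del -> r + del <= k%:R * q%:R * del -> 0 <= x <= r ->
  ~ (exists m : nat, x / del + w%:R / N%:R = m%:R) ->
  exists (b : 'I_k) (p : 'I_q),
    0 < x - (del * q%:R * b%:R - del * w%:R / N%:R + del * p%:R) < del.
Proof.
move=> del0 rk /andP[x0 xr] nint.
have N0 : 0 < N%:R :> R by rewrite ltr0n; apply: leq_ltn_trans (ltn_ord w).
have wN : w%:R / N%:R < 1 :> R by rewrite ltr_pdivrMr// mul1r ltr_nat.
set v := x / del + w%:R / N%:R in nint.
have v0 : 0 <= v by rewrite addr_ge0 ?divr_ge0// ltW.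
pose z := Num.truncn v.
have /andP[zv vz] : z%:R <= v < z.+1%:R by exact: truncn_itv.
have {}zv : z%:R < v.
  by rewrite lt_neqAle zv andbT; apply/eqP => vE; apply: nint; exists z.
have vE : del * v = x + del * w%:R / N%:R by rewrite /v; field; rewrite !gt_eqF.
(* The spare [del] in the hypothesis on r pays for the shift, which is less than one cell. *)
have zkq : (z < k * q)%N.
  rewrite -(ltr_nat R) natrM (lt_le_trans zv)// -(ler_pM2l del0) vE.
  rewrite [X in _ <= X]mulrC; apply: le_trans rk; rewrite lerD// -mulrA.
  by rewrite ler_piMr// ltW.
have q0 : (0 < q)%N by case: q zkq {rk} => //; rewrite muln0.
have bk : (z %/ q < k)%N by rewrite ltn_divLR.
exists (Ordinal bk), (Ordinal (ltn_pmod z q0)) => /=.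
have zE : del * z%:R = del * q%:R * (z %/ q)%:R + del * (z %% q)%:R :> R.
  by rewrite {1}(divn_eq z q) natrD natrM; ring.
have h1 : del * z%:R < x + del * w%:R / N%:R by rewrite -vE ltr_pM2l.
have h2 : x + del * w%:R / N%:R < del * z%:R + del.
  by rewrite -vE -[X in _ + X]mulr1 -mulrDr natr1 ltr_pM2l.
by lra.
Qed.

End Cells.

Section Enorm.
Context {R : realType} {n : nat}.
Implicit Types x y : 'rV[R]_n.

Lemma enorm_lt2 x : (enorm x < 2) = (\sum_(i < n) x 0 i ^+ 2 < 4).
Proof.
have -> : 2 = Num.sqrt 4 :> R by rewrite -[4]/(2 * 2)%:R natrM -expr2 sqrtr_sqr ger0_norm.
by rewrite /enorm ltr_sqrt.
Qed.

Lemma enorm_gt0 x : (0 < enorm x) = (x != 0).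
Proof.
rewrite /enorm sqrtr_gt0 lt_neqAle sumr_ge0 ?andbT; last by move=> *; exact: sqr_ge0.
congr (~~ _); rewrite eq_sym psumr_eq0; last by move=> *; exact: sqr_ge0.
apply/allP/eqP => [x0|-> i _]; last by rewrite /= mxE expr0n eqxx.
apply/rowP => i; have := x0 i (mem_index_enum i).
by rewrite /= sqrf_eq0 mxE => /eqP.
Qed.

Lemma edgeE (C : set 'rV[R]_n) (x y : C) :
  edge x y = (x != y) && (\sum_(i < n) (val x 0 i - val y 0 i) ^+ 2 < 4).
Proof.
rewrite /edge enorm_gt0 enorm_lt2 subr_eq0 (inj_eq val_inj); congr (_ && (_ < _)).
by apply: eq_bigr => i _; rewrite !mxE.
Qed.

End Enorm.

(** Double counting: m times the indicator of B is at most the sum of the indicators of the [A i],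
    and this is integrated. *)
Lemma mule_measure_le_sum {d} {T : measurableType d} {R : realType}
    (mu : {measure set T -> \bar R}) (I : finType) (A : I -> set T) (B : set T) (m : nat) :
  (forall i, measurable (A i)) -> measurable B ->
  (forall x, B x -> (m <= #|[pred i | x \in A i]|)%N) ->
  (m%:R%:E * mu B <= \sum_i mu (A i))%E.
Proof.
move=> mA mB mBA.
have -> : (\sum_i mu (A i) = \int[mu]_x \sum_i (\1_(A i) x)%:E)%E.
  rewrite ge0_integral_sum//.
  - by apply: eq_bigr => i _; rewrite integral_indic// setIT.
  - by move=> i; apply/measurable_EFinP/measurable_indic.
have -> : (m%:R%:E * mu B = \int[mu]_x (m%:R%:E * (\1_B x)%:E))%E.
  rewrite ge0_integralZl//.
  - by rewrite integral_indic// setIT.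
  - exact/measurable_EFinP/measurable_indic.
apply: ge0_le_integral => //.
- by apply/measurable_EFinP; apply: measurable_funM => //; exact: measurable_indic.
- by apply: emeasurable_sum => i; apply/measurable_EFinP/measurable_indic.
move=> x _; rewrite sumEFin -EFinM lee_fin indicE.
have [/set_mem Bx|_] := boolP (x \in B); last first.
  by rewrite mulr0 sumr_ge0.
rewrite mulr1; apply: le_trans (_ : #|[pred i | x \in A i]|%:R <= _); first by rewrite ler_nat mBA.
rewrite -sum1_card natr_sum big_mkcond/=; apply: ler_sum => i _.
by rewrite inE indicE; case: (x \in A i).
Qed.

(** * Blocks of cells in N shifted grids of mesh [del] *)

Section Grid.
Context {R : realType} {n : nat}.
Variables (t N q k : nat) (del e r s : R).
Hypothesis t_gt0 : (1 <= t)%N.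
Hypothesis nN : (n < N)%N.
Hypothesis del_gt0 : 0 < del.
Hypothesis e_gt0 : 0 < e.
Hypothesis s_gt0 : 0 < s.
Hypothesis r_gt0 : 0 < r.
(** The three conditions say that stretching by 1 + e outweighs the diameter of a cell, that q
    stretched grid points in a row span at most s, and that k blocks of q cells cover [0, r] with
    one cell to spare. *)
Hypothesis del_small : del * (1 + e) * n.+1%:R <= 2 * e.
Hypothesis q_s : (1 + e) * del * q%:R <= s + (1 + e) * del.
Hypothesis k_r : r + del <= k%:R * q%:R * del.

Let C := dilate r (unit_cube R n).

Let grid : set 'rV[R]_n :=
  [set y | exists p : {ffun 'I_n -> 'I_q}, y = \row_i ((1 + e) * del * (p i)%:R)].

Let finite_grid : finite_set grid.
Proof.
rewrite (_ : grid = [set \row_i ((1 + e) * del * (p i)%:R) |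
  p in [set: {ffun 'I_n -> 'I_q}]]).
  by apply: finite_image; exact: finite_finset.
by apply/seteqP; split => y [p] => [->|_ <-]; exists p.
Qed.

Let grid_subset : grid `<=` dilate s (unit_cube R n).
Proof.
move=> _ [p ->]; exists (s^-1 *: \row_i ((1 + e) * del * (p i)%:R)); last first.
  by rewrite scalerA divff ?scale1r// gt_eqF.
move=> i; rewrite !mxE mulrC; apply/andP; split.
  by rewrite !mulr_ge0// ?invr_ge0 ?ltW// addr_gt0.
rewrite ler_pdivrMr// mul1r.
have pq : ((p i)%:R + 1 <= q%:R :> R) by rewrite natr1 ler_nat.
have ed : 0 < (1 + e) * del by rewrite mulr_gt0// addr_gt0.
have := ler_wpM2l (ltW ed) pq; have := q_s.
lra.
Qed.

Section Cell.
Variables (w : 'I_N) (b : {ffun 'I_n -> 'I_k}).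

(* The lower corner of the cell with label y in block b of the w-th shifted grid;
   labels are stretched by 1 + e to absorb the diameter of the cells. *)
Definition cell_low (y : grid) i : R :=
  del * q%:R * (b i)%:R - del * w%:R / N%:R + val y 0 i / (1 + e).

(** The least slack in the inequalities defining the open cell, capped at 1: a continuous function
    positive exactly on the cell. *)
Definition cell_depth (y : grid) (x : C) : R :=
  \big[Num.min/1]_(i < n)
    Num.min (val x 0 i - cell_low y i) (cell_low y i + del - val x 0 i).

Lemma cell_depth_gt0 y x : 0 < cell_depth y x <->
  forall i, cell_low y i < val x 0 i < cell_low y i + del.
Proof.
split=> [/bigmin_gtP[_ xy] i|xy].
  by have := xy i isT; rewrite lt_min !subr_gt0.
apply/bigmin_gtP; split=> // i _.
by rewrite lt_min !subr_gt0; exact: xy.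
Qed.

Lemma continuous_cell_depth y : continuous (cell_depth y).
Proof.
rewrite /cell_depth; elim: (index_enum _) => [|i l ih] x.
  by under eq_fun do rewrite big_nil; exact: (@cst_continuous C R 1).
under eq_fun do rewrite big_cons.
have cx : {for x, continuous (fun x : C => val x 0 i)}.
  apply: (@continuous_comp _ _ _ (@set_val _ C) (fun v : 'rV[R]_n => v 0 i)).
    exact: initial_continuous.
  exact: coord_continuous.
apply: (@continuous_min R C (fun x : C =>
  Num.min (val x 0 i - cell_low y i) (cell_low y i + del - val x 0 i))); last exact: ih.
apply: (@continuous_min R C (fun x : C => val x 0 i - cell_low y i)).
  exact: (cvgB cx (@cst_continuous C R (cell_low y i) x)).
exact: (cvgB (@cst_continuous C R (cell_low y i + del) x) cx).
Qed.

Let disjoint_cell y y' x : 0 < cell_depth y x -> 0 < cell_depth y' x -> y = y'.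
Proof.
move=> /cell_depth_gt0 xy /cell_depth_gt0 xy'; apply: val_inj; apply/rowP => i.
have /andP[h1 h2] := xy i; have /andP[h3 h4] := xy' i.
have [p yp] := set_mem (valP y); have [p' yp'] := set_mem (valP y').
move: h1 h2 h3 h4; rewrite /cell_low yp yp' !mxE.
have e0 : 1 + e != 0 by rewrite gt_eqF// addr_gt0.
have cancel_e c : (1 + e) * del * c / (1 + e) = del * c by field.
rewrite !cancel_e.
move=> h1 h2 h3 h4; congr (_ * _); apply/eqP; rewrite eqr_nat.
have : del * (p i)%:R < del * (p' i).+1%:R by rewrite -natr1 mulrDr mulr1; lra.
have : del * (p' i)%:R < del * (p i).+1%:R by rewrite -natr1 mulrDr mulr1; lra.
by rewrite !ltr_pM2l// !ltr_nat !ltnS => a1 a2; rewrite eqn_leq a1 a2.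
Qed.

Let n_del : n%:R * (del * (1 + e)) ^+ 2 <= 4 * e ^+ 2.
Proof.
have D0 : 0 <= del * (1 + e) by rewrite mulr_ge0 ?addr_ge0// ltW.
have h : (del * (1 + e) * n.+1%:R) ^+ 2 <= (2 * e) ^+ 2.
  have e0 : 0 <= 2 * e by have := e_gt0; lra.
  have D1 : 0 <= del * (1 + e) * n.+1%:R by exact: mulr_ge0.
  by rewrite ler_sqr.
have -> : 4 * e ^+ 2 = (2 * e) ^+ 2 by ring.
apply: le_trans h; rewrite mulrC [leRHS]exprMn -natrX ler_wpM2l ?sqr_ge0// ler_nat.
by rewrite expnS expn1 mulSn (leq_trans (leqnSn n)) ?leq_addr.
Qed.

Let clique_cell y x x' :
  0 < cell_depth y x -> 0 < cell_depth y x' -> x != x' -> edge x x'.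
Proof.
move=> /cell_depth_gt0 xy /cell_depth_gt0 xy' xx'; rewrite edgeE xx'/=.
apply: le_lt_trans (_ : \sum_(i < n) del ^+ 2 < 4).
  apply: ler_sum => i _; have /andP[h1 h2] := xy i; have /andP[h3 h4] := xy' i.
  have hx : `|val x 0 i - val x' 0 i| <= del.
    by rewrite ler_norml; apply/andP; split; lra.
  by rewrite -[leLHS]real_normK ?num_real// ler_sqr ?nnegrE// (le_trans _ hx).
rewrite sumr_const card_ord -[ltLHS]mulr_natl.
have e2 : 0 < (1 + e) ^+ 2 by rewrite exprn_gt0// addr_gt0.
rewrite -(ltr_pM2r e2).
have -> : n%:R * del ^+ 2 * (1 + e) ^+ 2 = n%:R * (del * (1 + e)) ^+ 2 by ring.
apply: le_lt_trans n_del _.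
have -> : 4 * (1 + e) ^+ 2 = 4 * e ^+ 2 + 8 * e + 4 by ring.
by have := e_gt0; lra.
Qed.

(** Undoing the stretch shrinks a label distance below 2 to below 2 / (1 + e), and the widths of the
    cells add at most the 2e / (1 + e) left by [del_small]. The estimate is carried out with
    squares. *)
Let edge_cell y y' x x' :
  0 < cell_depth y x -> 0 < cell_depth y' x' -> edge y y' -> edge x x'.
Proof.
rewrite !edgeE => dx dx' /andP[yy' yy'4].
have -> : x != x'.
  by apply: contraNneq yy' => xx'; rewrite -xx' in dx'; apply/eqP; exact: disjoint_cell dx dx'.
move: dx dx' => /cell_depth_gt0 xy /cell_depth_gt0 xy'.
have e1 : 0 < 1 + e by rewrite addr_gt0.
have step i : (val x 0 i - val x' 0 i) ^+ 2 <=
    (val y 0 i - val y' 0 i) ^+ 2 / (1 + e) + (1 + e) / e * del ^+ 2.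
  have /andP[h1 h2] := xy i; have /andP[h3 h4] := xy' i.
  move: h1 h2 h3 h4; rewrite /cell_low.
  set a := val y 0 i; set a' := val y' 0 i; set z := val x 0 i; set z' := val x' 0 i.
  move=> h1 h2 h3 h4.
  pose v := (a - a') / (1 + e).
  have hz : `|z - z'| <= `|v| + del.
    have := ler_norm v; have := ler_norm (- v); rewrite normrN ler_norml /v mulrBl.
    by lra.
  have -> : (a - a') ^+ 2 / (1 + e) = (1 + e) * `|v| ^+ 2.
    by rewrite real_normK ?num_real// /v; field; rewrite gt_eqF.
  have hz2 : (z - z') ^+ 2 <= (`|v| + del) ^+ 2.
    by rewrite -[leLHS]real_normK ?num_real// ler_sqr ?nnegrE// (le_trans _ hz).
  (* The weighted inequality (a + b)^2 <= (1 + e) a^2 + (1 + 1/e) b^2, whose defect is e times a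
     square. *)
  apply: le_trans hz2 _; rewrite -subr_ge0.
  have -> : (1 + e) * `|v| ^+ 2 + (1 + e) / e * del ^+ 2 - (`|v| + del) ^+ 2 =
      e * (`|v| - del / e) ^+ 2 by field; rewrite gt_eqF.
  by rewrite mulr_ge0 ?sqr_ge0// ltW.
rewrite /=; apply: le_lt_trans (ler_sum _ (fun i _ => step i)) _.
rewrite big_split/= -mulr_suml sumr_const card_ord -[X in _ + X]mulr_natl.
have e2 : 0 < (1 + e) * e by rewrite mulr_gt0.
rewrite -(ltr_pM2r e2); move: yy'4; set Y := \sum_(i < n) _ => yy'4.
have -> : (Y / (1 + e) + n%:R * ((1 + e) / e * del ^+ 2)) * ((1 + e) * e) =
    Y * e + n%:R * (del * (1 + e)) ^+ 2 by field; rewrite !gt_eqF.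
have := n_del; have : Y * e < 4 * e by rewrite ltr_pM2r.
by lra.
Qed.

Lemma las_top_cell (lam : {finite_measure set (borel_indep (2 * t) C) -> \bar R}) :
  las_feasible lam ->
  (lam (\bigcup_y hitting cell_depth (t := t) [fset y]%fset) <= las t (dilate s (unit_cube R n)))%E.
Proof.
move=> lam_feas; apply: le_trans (las_top_discretize t_gt0 finite_grid
  continuous_cell_depth disjoint_cell clique_cell edge_cell lam_feas) _.
by apply: ereal_sup_ubound; exists grid.
Qed.

End Cell.

Lemma las_top_grid :
  ((N - n)%:R%:E * las_top t (dilate r (unit_cube R n)) <=
   (N * k ^ n)%:R%:E * las t (dilate s (unit_cube R n)))%E.
Proof.
have Nn : 0 < (N - n)%:R :> R by rewrite ltr0n subn_gt0.
rewrite -lee_pdivlMl//; apply: ge_ereal_sup => _ [lam lam_feas <-].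
rewrite lee_pdivlMl//.
pose A (wb : 'I_N * {ffun 'I_n -> 'I_k}) :=
  \bigcup_y hitting (cell_depth wb.1 wb.2) (t := t) [fset y]%fset.
have mA wb : measurable (A wb).
  apply: fin_bigcup_measurable; first exact: finite_setT_set_type finite_grid.
  by move=> y _; apply: measurable_hitting; exact: continuous_cell_depth.
apply: le_trans (mule_measure_le_sum lam mA (@measurable_card_vset R n C _ 1) _) _; last first.
  apply: (@le_trans _ _ (\sum_(wb : 'I_N * {ffun 'I_n -> 'I_k})
    las t (dilate s (unit_cube R n)))%E).
    by apply: lee_sum => wb _; exact: las_top_cell.
  rewrite sumr_const card_prod card_ffun !card_ord.
  by rewrite mule_natl.
move=> S /= /eqP/cardfs1P[x Sx].
have xC i : 0 <= val x 0 i <= r.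
  have [v vI <-] := set_mem (valP x); rewrite mxE.
  have /andP[v0 v1] := vI i.
  by rewrite mulr_ge0 ?(ltW r_gt0)//= ler_piMr// ltW.
pose hit i (w : 'I_N) :=
  `[< exists m : nat, (val x 0 i / del + w%:R / N%:R = m%:R)%R >].
(* The shifts for which x lies on a wall in some direction: at most one per direction. *)
pose bad : pred 'I_N := [pred w | [exists i, hit i w]].
have bad_card : (#|bad| <= n)%N.
  rewrite -sum1_card big_mkcond/=.
  apply: (@leq_trans (\sum_(w < N) \sum_(i < n) hit i w)%N).
    apply: leq_sum => w _; rewrite [w \in bad]/(bad w)/=.
    by case: existsP => [[i iw]|//]; rewrite (bigD1 i)//= iw.
  rewrite exchange_big/= -[leqRHS]card_ord -sum1_card; apply: leq_sum => i _.
  apply: leq_trans (card_grid_hits N (val x 0 i / del)).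
  rewrite -[leqRHS]sum1_card [leqRHS]big_mkcond/=; apply: leq_sum => w _.
  by change (hit i w <= (if hit i w then 1 else 0))%N; case: (hit i w).
apply: (@leq_trans #|[predC bad]|).
  by rewrite leq_subLR -{1}(card_ord N) -(cardC bad) leq_add2r.
(* It suffices that each good shift w is the first component of some pair (w, b) such that block b
   of shift w has a cell containing x. *)
apply: leq_trans (leq_image_card fst _); apply: subset_leq_card.
apply/fintype.subsetP => w; rewrite inE => wbad.
have /fin_all_exists[bp bpP] i : exists bp : 'I_k * 'I_q,
    0 < val x 0 i - (del * q%:R * bp.1%:R - del * w%:R / N%:R + del * bp.2%:R) < del.
  have [|b [p bpP]] := @cell_ex R N q k del r (val x 0 i) w del_gt0 k_r (xC i).
    by move=> xm; move/negP: wbad; apply; apply/existsP; exists i; exact/asboolP.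
  by exists (b, p).
pose b := [ffun i => (bp i).1].
have yP : grid (\row_i ((1 + e) * del * (bp i).2%:R)).
  by exists [ffun i => (bp i).2]; apply/rowP => i; rewrite !mxE ffunE.
pose y : grid := exist _ (\row_i ((1 + e) * del * (bp i).2%:R)) (mem_set yP).
apply/fintype.imageP; exists (w, b) => //; rewrite inE; exists y => //.
rewrite /hitting/= /hits Sx !cardfs1 eqxx/=; apply/allP => z.
rewrite inE => /eqP ->; apply/peak_gt0P; exists x; first by rewrite inE.
apply/cell_depth_gt0 => i; rewrite /cell_low !mxE ffunE.
have e0 : 1 + e != 0 by rewrite gt_eqF// addr_gt0.
have -> : (1 + e) * del * (bp i).2%:R / (1 + e) = del * (bp i).2%:R by field.
have /andP[h1 h2] := bpP i.
by apply/andP; split; lra.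
Qed.
End Grid.

(** * Growth of the bounds *)

Section Growth.
Context {R : realType} (n t : nat).
Hypothesis t_gt0 : (1 <= t)%N.

Let a (r : R) : \bar R := las t (dilate r (unit_cube R n)).
Let b (r : R) : \bar R := las_top t (dilate r (unit_cube R n)).

Lemma las_le_las_top (C : set 'rV[R]_n) : (las t C <= las_top t C)%E.
Proof. by apply: ge_ereal_sup => _ [F [finF FC] <-]; exact: las_top_subset. Qed.

Lemma las_ge0 (C : set 'rV[R]_n) : (0 <= las t C)%E.
Proof.
apply: le_trans (las_top_ge0 t set0) _; apply: ereal_sup_ubound.
by exists set0 => //; split; [exact: finite_set0|exact: sub0set].
Qed.

(** In a cube of side 1 / (n + 1) squared distances are at most n / (n + 1), so every finite subset
    is a clique. This starts the finiteness of all the bounds. *)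
Let las_small_cube : exists2 s : R, 0 < s & (a s <= 1)%E.
Proof.
exists n.+1%:R^-1; first by rewrite invr_gt0.
apply: ge_ereal_sup => _ [F [finF FC] <-]; apply: las_top_clique => // x y xy.
rewrite edgeE xy/=.
have n1 : 0 < n.+1%:R :> R by [].
have coord (z : F) i : 0 <= val z 0 i <= n.+1%:R^-1.
  have [v vI <-] := FC _ (set_mem (valP z)); rewrite mxE.
  have /andP[v0 v1] := vI i.
  by rewrite mulr_ge0 ?invr_ge0//= ler_piMr// invr_ge0.
apply: le_lt_trans (_ : \sum_(i < n) n.+1%:R^-1 < 4).
  apply: ler_sum => i _; have /andP[x0 x1] := coord x i; have /andP[y0 y1] := coord y i.
  have s1 : n.+1%:R^-1 <= 1 :> R by rewrite invf_le1// ler1n.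
  have hx : `|val x 0 i - val y 0 i| <= n.+1%:R^-1.
    move: x0 x1 y0 y1; move: (val x 0 i) (val y 0 i) (n.+1%:R^-1) => u v c *.
    by rewrite ler_norml; apply/andP; split; lra.
  rewrite -[leLHS]real_normK ?num_real// expr2.
  by apply: le_trans (ler_pM _ _ hx (le_trans hx s1)) _; rewrite ?mulr1.
rewrite sumr_const card_ord -[ltLHS]mulr_natl ltr_pdivrMr//.
by apply: lt_le_trans (_ : n.+1%:R <= _); [rewrite ltr_nat|rewrite ler_peMl ?ler1n// ltW].
Qed.

Let las_top_le_las (e r s : R) (N : nat) : 0 < e -> 0 < r -> 0 < s -> (n < N)%N ->
  exists2 k : nat,
    k%:R <= (1 + e) * (r + 2 * e / ((1 + e) * n.+1%:R)) / s + 1 &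
    ((N - n)%:R%:E * b r <= (N * k ^ n)%:R%:E * a s)%E.
Proof.
move=> e0 r0 s0 nN.
have e1 : 0 < 1 + e by rewrite addr_gt0.
have n1 : 0 < n.+1%:R :> R by [].
(* The largest mesh allowed: [del_small] becomes an equality. *)
set del := 2 * e / _.
have del0 : 0 < del by rewrite /del divr_gt0// mulr_gt0.
have ed0 : 0 < (1 + e) * del by rewrite mulr_gt0.
(* The number of stretched grid points 0, ..., q - 1 that fit in [0, s]; then k is chosen just large
   enough for the blocks to cover. *)
pose q := (Num.truncn (s / ((1 + e) * del))).+1.
pose k := (Num.truncn ((r + del) / (q%:R * del))).+1.
have q0 : 0 < q%:R :> R by [].
have /andP[qs sq] : (Num.truncn (s / ((1 + e) * del)))%:R <= s / ((1 + e) * del) < q%:R.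
  by apply: truncn_itv; rewrite divr_ge0 ?ltW.
have rdel : 0 < r + del by rewrite addr_gt0.
have qdel : 0 < q%:R * del by rewrite mulr_gt0.
have /andP[kr rk] : (Num.truncn ((r + del) / (q%:R * del)))%:R <= (r + del) / (q%:R * del) < k%:R.
  by apply: truncn_itv; rewrite divr_ge0 ?ltW.
exists k.
  rewrite /k -natr1 lerD2r; apply: le_trans kr _.
  rewrite ler_pdivrMr// mulrAC ler_pdivlMr//.
  (* A block has side more than s / (1 + e), which bounds k from above. *)
  move: sq; rewrite ltr_pdivrMr// => /ltW sq.
  by have := ler_wpM2l (ltW rdel) sq; lra.
apply: (@las_top_grid R n t N q k del e r s) => //.
- by rewrite /del -mulrA divfK// gt_eqF// mulr_gt0.
- move: qs; rewrite ler_pdivlMr// /q -natr1; lra.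
- by move: rk; rewrite ltr_pdivrMr// mulrA => /ltW.
Qed.

(** Comparison with the small cube, for e = 1 and N = n + 1, so that the factor N - n is 1. *)
Let b_fin r : 0 < r -> b r \is a fin_num.
Proof.
move=> r0; have [s s0 as1] := las_small_cube.
have [k _] := las_top_le_las ltr01 r0 s0 (ltnSn n).
rewrite subSnn mul1e => bk; rewrite ge0_fin_numE ?las_top_ge0//.
apply: le_lt_trans bk _; apply: le_lt_trans (lee_wpmul2l _ as1) _.
  by rewrite lee_fin.
by rewrite mule1 ltry.
Qed.

Let a_fin r : 0 < r -> a r \is a fin_num.
Proof.
move=> /b_fin; rewrite !ge0_fin_numE ?las_top_ge0 ?las_ge0//.
by apply: le_lt_trans; exact: las_le_las_top.
Qed.

Let b_le_a (e r s : R) : 0 < e -> 0 < r -> 0 < s ->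
  2 * e / n.+1%:R + s <= e * r ->
  fine (b r) / r ^+ n <= (1 + 2 * e) ^+ n.+1 * (fine (a s) / s ^+ n).
Proof.
move=> e0 r0 s0 re.
(* Large enough that N <= (1 + 2e)(N - n); the summand n secures n < N. *)
pose N := (Num.truncn (n%:R * (1 + 2 * e) / (2 * e)) + n).+1.
have nN : (n < N)%N by rewrite /N ltnS leq_addl.
have [k ks] := las_top_le_las e0 r0 s0 nN.
have as0 : 0 <= fine (a s) by rewrite fine_ge0// las_ge0.
rewrite -(fineK (b_fin r0)) -(fineK (a_fin s0)) -!EFinM lee_fin => ba.
have e1 : 0 < 1 + e by rewrite addr_gt0.
(* The assumption on r absorbs the margin 2e / (n + 1) and the rounding of k, which costs s, into e
   * r. *)
have k_rs : k%:R <= (1 + 2 * e) * (r / s).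
  apply: le_trans ks _; rewrite [leRHS]mulrA ler_pdivlMr// mulrDl divfK ?gt_eqF//.
  have n1 : n.+1%:R != 0 :> R by rewrite pnatr_eq0.
  have -> : (1 + e) * (r + 2 * e / ((1 + e) * n.+1%:R)) = (1 + e) * r + 2 * e / n.+1%:R.
    by move: n1; move: (n.+1%:R : R) => u u0; field; rewrite u0 gt_eqF.
  by move: re; move: (2 * e / n.+1%:R) => u; lra.
have N_n : N%:R <= (1 + 2 * e) * (N - n)%:R :> R.
  have : n%:R * (1 + 2 * e) / (2 * e) < N%:R.
    apply: lt_le_trans (truncnS_gt _) _; by rewrite ler_nat /N ltnS leq_addr.
  by rewrite ltr_pdivrMr ?mulr_gt0// natrB ?(ltnW nN)// => ?; lra.
have Nn : 0 < (N - n)%:R :> R by rewrite ltr0n subn_gt0.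
rewrite -(ler_pM2l Nn) [leLHS]mulrA ler_pdivrMr ?exprn_gt0//; apply: le_trans ba _.
have -> : (N - n)%:R * ((1 + 2 * e) ^+ n.+1 * (fine (a s) / s ^+ n)) * r ^+ n =
    ((1 + 2 * e) * (N - n)%:R) * ((1 + 2 * e) * (r / s)) ^+ n * fine (a s).
  by rewrite exprS !exprMn exprVn; ring.
rewrite natrM natrX ler_wpM2r// ler_pM ?exprn_ge0//.
apply: lerXn2r => //; rewrite nnegrE; first exact: ler0n.
exact: le_trans (ler0n _ _) k_rs.
Qed.

(** The common limit is the infimum of [a s] / s^n over s > 0. It lies below [a r] / r^n, hence
    below [b r] / r^n, while [b_le_a] with s nearly optimal bounds the latter from above for large
    r. *)
Lemma las_limit : exists l : R,
  (b r / (r ^+ n)%:E)%E @[r --> +oo%R] --> l%:E /\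
  (a r / (r ^+ n)%:E)%E @[r --> +oo%R] --> l%:E.
Proof.
pose E := [set x : R | exists2 s, 0 < s & x = fine (a s) / s ^+ n].
have E_ge0 : lbound E 0.
  by move=> _ [s s0 ->]; rewrite divr_ge0 ?exprn_ge0 ?fine_ge0 ?las_ge0// ltW.
have infE : has_inf E.
  by split; [exists (fine (a 1) / 1 ^+ n), 1|exists 0].
exists (inf E).
have divE (f : R -> \bar R) r : 0 < r -> f r \is a fin_num ->
    (f r / (r ^+ n)%:E)%E = (fine (f r) / r ^+ n)%:E.
  move=> r0 /fineK fr; rewrite inver expf_eq0 (gt_eqF r0) andbF -{1}fr.
  by rewrite EFinM.
have near_le eps : 0 < eps -> \forall r \near +oo%R,
    [/\ 0 < r, inf E <= fine (a r) / r ^+ n, fine (a r) <= fine (b r) &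
     fine (b r) / r ^+ n <= inf E + eps].
  move=> eps0.
  have [_ [s s0 ->]] := inf_adherent (divr_gt0 eps0 (ltr0Sn _ 1)) infE.
  set x := _ / _ => xE.
  (* The factor (1 + 2e)^(n + 1) tends to 1 as e decreases to 0, so its cost is at most the other
     half of eps. *)
  have [e e0 ex] : exists2 e, 0 < e & (1 + 2 * e) ^+ n.+1 * x <= x + eps / 2.
    have cvg_x : (1 + 2 * e) ^+ n.+1 * x @[e --> (0 : R)^'+] --> x.
      apply: cvg_at_right_filter.
      have c1 : (1 + 2 * e) @[e --> (0 : R)] --> (1 + 2 * 0 : R).
        by apply: cvgD; [exact: cvg_cst|apply: cvgM; [exact: cvg_cst|exact: cvg_id]].
      rewrite mulr0 addr0 in c1.
      have c2 : (1 + 2 * e) ^+ n.+1 @[e --> (0 : R)] --> ((1 : R) ^+ n.+1).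
        exact: (cvg_comp _ _ c1 (@exprn_continuous R n.+1 1)).
      suff : (1 + 2 * e) ^+ n.+1 * x @[e --> (0 : R)] --> (1 ^+ n.+1 * x : R).
        by rewrite expr1n mul1r.
      by apply: cvgM; [exact: c2|exact: cvg_cst].
    have eps2 : 0 < eps / 2 by rewrite divr_gt0.
    near (0 : R)^'+ => e; exists e => //.
    have : `|x - (1 + 2 * e) ^+ n.+1 * x| <= eps / 2.
      by near: e; move/cvgrPdist_le : cvg_x; apply.
    by rewrite ler_norml => /andP[h _]; lra.
  near=> r.
  have r0 : 0 < r by near: r; exact: nbhs_pinfty_gt.
  split => //.
  - by apply: ge_inf; [exact: infE.2|exists r].
  - by apply: fine_le; rewrite ?a_fin ?b_fin ?las_le_las_top.
  - apply: le_trans (b_le_a e0 r0 s0 _) _; last by move: ex xE; rewrite -/x; lra.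
    by rewrite [leRHS]mulrC -ler_pdivrMr//; near: r; apply: nbhs_pinfty_ge; exact: num_real.
split; apply: cvg_EFin.
- near=> r; have r0 : 0 < r by near: r; exact: nbhs_pinfty_gt.
  by rewrite divE// b_fin.
- apply/cvgrPdist_le => eps eps0; near=> r.
  have [r0 h1 h2 h3] : [/\ 0 < r, inf E <= fine (a r) / r ^+ n,
     fine (a r) <= fine (b r) & fine (b r) / r ^+ n <= inf E + eps].
    by near: r; exact: near_le.
  rewrite /= divE ?b_fin//= ler_norml.
  have : fine (a r) / r ^+ n <= fine (b r) / r ^+ n.
    by rewrite ler_pM2r// invr_gt0 exprn_gt0.
  by move=> h4; apply/andP; split; lra.
- near=> r; have r0 : 0 < r by near: r; exact: nbhs_pinfty_gt.
  by rewrite divE// a_fin.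
- apply/cvgrPdist_le => eps eps0; near=> r.
  have [r0 h1 h2 h3] : [/\ 0 < r, inf E <= fine (a r) / r ^+ n,
     fine (a r) <= fine (b r) & fine (b r) / r ^+ n <= inf E + eps].
    by near: r; exact: near_le.
  rewrite /= divE ?a_fin//= ler_norml.
  have : fine (a r) / r ^+ n <= fine (b r) / r ^+ n.
    by rewrite ler_pM2r// invr_gt0 exprn_gt0.
  by move=> h4; apply/andP; split; lra.
Unshelve. all: by end_near.
Qed.

End Growth.

Theorem corollary6p14 (R : realType) (n t : nat) (ht : (1 <= t)%N) :
  exists l : R,
    (las_top t (dilate r (unit_cube R n)) / (r ^+ n)%:E)%E
      @[r --> +oo%R] --> l%:E /\
    (las t (dilate r (unit_cube R n)) / (r ^+ n)%:E)%E
      @[r --> +oo%R] --> l%:E.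
Proof. exact: las_limit. Qed.
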